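(* Suppose $\phi$ is close to a cone at $\infty$. Suppose moreover that at least one of the following holds: (a) $F$ is concave; or (b) $g$ grows superlinearly in the second variable, i.e. $g(x,t)/t\to+\infty$ as $t\to+\infty$, locally uniformly in $x$. Then there exists a unique viscosity solution $u$ to the Dirichlet problem $$\begin{cases}\int \frac{F(\delta u(x,y))}{|y|^{n+\sigma}}dy= g(x,u-\phi) & \text{in } \mathbb{R}^n\\ u-\phi\to 0 & \text{at }\infty.\end{cases}$$
   Context: $n$ is the dimension of the space and $\sigma\in(1,2)$ is fixed. For a function $u$ on $\mathbb{R}^n$, $\delta u(x,y)=u(x+y)+u(x-y)-2u(x)$. Integrals in $dy$ are over $\mathbb{R}^n$. Standing assumptions, with constants $L_1,\dots,L_5$ and $\mu>0$: (i) $F:\mathbb{R}\to\mathbb{R}$ is $C^1$, $F(0)=0$, $\mathrm{Lip}(F)<L_1$, and $F'>0$. (ii) $g:\mathbb{R}^n\times\mathbb{R}\to\mathbb{R}$ is continuous and satisfies $|g(x,t)-g(x',t)|<L_2|x-x'|$ for $x\ne x'$ and all $t$; $g(x,t)-g(x,s)\ge\mu(t-s)$ whenever $t>s$; and $g(x,0)=0$ for all $x\in\mathbb{R}^n$. (iii) $\phi:\mathbb{R}^n\to\mathbb{R}$ is a convex Lipschitz $C^{1,1}$ function with $0\le D^2\phi\le L_3$, $\mathrm{Lip}(\phi)\le L_4$, and $\int|\phi(y)|\frac{1}{(1+|y|)^{n+\sigma}}dy\le L_5$. Close to a cone: $\phi$ is close to a cone at $\infty$ if $\phi=\Gamma+\eta$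 near infinity, where $\Gamma$ is a cone (a function positively homogeneous of degree one), and for some $C$ and $0<\epsilon<n$ one has $|\eta(x)|\le C|x|^{-\epsilon}$, $|\nabla\eta(x)|\le C|x|^{-1-\epsilon}$, $|D^2\eta(x)|\le C|x|^{-2-\epsilon}$. Viscosity sense: write $I[w,x]=\int\frac{F(\delta w(x,y))}{|y|^{n+\sigma}}dy$ and let $f$ be continuous. An upper semicontinuous function $w$ with $w\in L^1\big(\frac{1}{(1+|y|)^{n+\sigma}}dy\big)$ is a (viscosity) subsolution, i.e. $I[w,x]\ge f(x)$ in $\Omega$ in the viscosity sense, if for any $x\in\Omega$ and any $\eta$ that is $C^{1,1}$ in some open set $U\ni x$ with $\eta(x)=w(x)$ and $\eta\ge w$ in $U$, the function $\tilde\eta$ equal to $\eta$ in $U$ and to $w$ outside $U$ satisfies $I[\tilde\eta,x]\ge f(x)$ in the classical pointwise sense. Supersolutions ($I[w,x]\le f(x)$) are defined analogously, with lower semicontinuous $w$, $\eta\le w$ in $U$ and the reversed inequality. A solution is at the same time a subsolution and a supersolution. For the right-hand side $g(x,w-\phi)$ one takes $f(x)=g(x,w(x)-\phi(x))$. *)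

(* Defs.v *)
From HB Require Import structures.
From mathcomp Require Import all_boot all_order all_algebra.
From mathcomp Require Import all_classical all_reals all_analysis.
Set Implicit Arguments.
Unset Strict Implicit.
Unset Printing Implicit Defensive.
Import Order.TTheory GRing.Theory Num.Theory.
Import numFieldNormedType.Exports.
Local Open Scope classical_set_scope.
Local Open Scope ring_scope.

Definition rV_display : measure_display. Proof. exact. Qed.

Section measurable_rV.
Context {R : realType} (n : nat).

Let coord (i : 'I_n) (x : 'rV[R]_n) : measurableTypeR R := x ord0 i.

Let rV_set0 : g_sigma_preimage coord set0.
Proof. exact: sigma_algebra0. Qed.

Let rV_setC A : g_sigma_preimage coord A -> g_sigma_preimage coord (~` A).
Proof. exact: sigma_algebraC. Qed.

Let rV_bigcup (F : (set 'rV[R]_n)^nat) :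
  (forall i, g_sigma_preimage coord (F i)) ->
  g_sigma_preimage coord (\bigcup_i (F i)).
Proof. exact: sigma_algebra_bigcup. Qed.

(* the product sigma-algebra, i.e. the Borel sets of R^n *)
HB.instance Definition _ := @isMeasurable.Build rV_display
  'rV[R]_n (g_sigma_preimage coord) rV_set0 rV_setC rV_bigcup.

Lemma measurable_coord (i : 'I_n) :
  measurable_fun [set: 'rV[R]_n] (fun x => x ord0 i : measurableTypeR R).
Proof.
move=> _ Y mY; rewrite setTI; apply: sub_sigma_algebra => /=.
rewrite -bigcup_seq/=; exists i => /=; first by rewrite mem_index_enum.
by exists Y => //; rewrite setTI.
Qed.

Lemma measurable_fun_rV d (T : measurableType d) (f : T -> 'rV[R]_n) :
  (forall i, measurable_fun setT (fun t => f t ord0 i : measurableTypeR R)) ->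
  measurable_fun setT f.
Proof.
move=> mf; apply: (@measurability _ _ _ _ _ _
  (\big[setU/set0]_(i < n) preimage_set_system setT (coord i) measurable)) => //.
move=> _ [B + <-]; rewrite -bigcup_seq => -[i _ [A mA <-]].
by rewrite !setTI; rewrite -[X in measurable X]setTI; exact: mf.
Qed.

End measurable_rV.

Section lebesgue_step.
Context {R : realType} (n : nat).

Definition rV_cons (p : measurableTypeR R * 'rV[R]_n) : 'rV[R]_n.+1 :=
  \row_i oapp (p.2 ord0) p.1 (unlift ord0 i).

Definition rV_uncons (x : 'rV[R]_n.+1) : measurableTypeR R * 'rV[R]_n :=
  (x ord0 ord0, \row_i x ord0 (lift ord0 i)).

Lemma rV_consK : cancel rV_cons rV_uncons.
Proof.
move=> [t x]; congr pair; first by rewrite mxE unlift_none.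
by apply/rowP => i; rewrite !mxE liftK.
Qed.

Lemma measurable_rV_cons : measurable_fun setT rV_cons.
Proof.
apply: measurable_fun_rV => i; under eq_fun do rewrite mxE.
case: (unliftP ord0 i) => [j|] _ /=; last exact: measurable_fst.
exact: (measurableT_comp (measurable_coord j) measurable_snd).
Qed.

Lemma measurable_rV_uncons : measurable_fun setT rV_uncons.
Proof.
apply: measurable_fun_pair; first exact: measurable_coord.
apply: measurable_fun_rV => i; under eq_fun do rewrite mxE.
exact: measurable_coord.
Qed.

Variable m : {sigma_finite_measure set 'rV[R]_n -> \bar R}.

Definition lebesgueS : set 'rV[R]_n.+1 -> \bar R :=
  pushforward (@lebesgue_measure R \x m)%E rV_cons.

HB.instance Definition _ := Measure.copy lebesgueS
  (measure_function_pushforward__canonical__measure_function_Measure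
     (@lebesgue_measure R \x m)%E measurable_rV_cons).

Lemma lebesgueSX A (B : set 'rV[R]_n) : measurable A -> measurable B ->
  lebesgueS (rV_uncons @^-1` (A `*` B)) = (@lebesgue_measure R A * m B)%E.
Proof.
move=> mA mB; rewrite /lebesgueS /pushforward -comp_preimage.
by rewrite (_ : _ \o _ = id) ?product_measure1E//; exact/funext/rV_consK.
Qed.

Let lebesgueS_sigma_finite : sigma_finite setT lebesgueS.
Proof.
have /sigma_finiteP[F [TF ndF Foo]] := sigma_finiteT (@lebesgue_measure R).
have /sigma_finiteP[G [TG ndG Goo]] := sigma_finiteT m.
exists (fun k => rV_uncons @^-1` (F k `*` G k)).
  apply/esym/seteqP; split => // x _.
  have [i _ Fi] : (\bigcup_i F i) (rV_uncons x).1 by rewrite -TF.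
  have [j _ Gj] : (\bigcup_i G i) (rV_uncons x).2 by rewrite -TG.
  exists (maxn i j) => //; split.
    by move: Fi; exact/subsetPset/ndF/leq_maxl.
  by move: Gj; exact/subsetPset/ndG/leq_maxr.
move=> k; have [mF Fk] := Foo k; have [mG Gk] := Goo k; split.
  rewrite -[X in measurable X]setTI; apply: measurable_rV_uncons => //.
  exact: measurableX.
by rewrite lebesgueSX// lte_mul_pinfty// ge0_fin_numE.
Qed.

HB.instance Definition _ := Measure_isSigmaFinite.Build _ _ _ lebesgueS
  lebesgueS_sigma_finite.

End lebesgue_step.

Fixpoint lebesgue_rV {R : realType} (n : nat) :
    {sigma_finite_measure set 'rV[R]_n -> \bar R} :=
  match n with
  | 0 => \d_(0 : 'rV[R]_0)
  | n'.+1 => lebesgueS (lebesgue_rV n')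
  end.

Lemma lebesgue_rV_box {R : realType} (n : nat) (A : 'I_n -> set (measurableTypeR R)) :
  (forall i, measurable (A i)) ->
  lebesgue_rV n [set x : 'rV[R]_n | forall i, A i (x ord0 i)] =
  (\prod_(i < n) lebesgue_measure (A i))%E.
Proof.
elim: n A => [|n IH] A mA.
  rewrite big_ord0 /= diracE mem_set//= => -[].
  by [].
rewrite big_ord_recl -IH//= -lebesgueSX//; last first.
  rewrite (_ : mkset _ = \big[setI/setT]_(i < n)
     ((fun x : 'rV[R]_n => x ord0 i : measurableTypeR R) @^-1` A (lift ord0 i))).
    apply: bigsetI_measurable => i _; rewrite -[X in measurable X]setTI.
    exact: measurable_coord.
  rewrite -bigcap_seq; apply/seteqP; split => x /= Ax i.
    by move=> _; exact: Ax.
  by apply: Ax; rewrite /= mem_index_enum.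
congr (lebesgueS _ _); apply/seteqP; split => x /= Ax.
  by split=> //= i; rewrite mxE.
move: Ax => [A0 A1] i; case: (unliftP ord0 i) => [j ->|->]//.
by have := A1 j; rewrite /= mxE.
Qed.

Section definitions.
Context {R : realType} (n : nat).
Implicit Types (x y : 'rV[R]_n) (f u w phi : 'rV[R]_n -> R)
  (U Omega : set 'rV[R]_n) (F : R -> R) (sigma : R).

(* the norm `|x| of the library on matrices is the sup norm; this one is the
   Euclidean norm on row vectors and the Frobenius norm on square matrices *)
Definition enorm p q (A : 'M[R]_(p, q)) : R :=
  Num.sqrt (\sum_i \sum_j A i j ^+ 2).

Definition grad f x : 'rV[R]_n := \row_i 'D_(delta_mx ord0 i) f x.

Definition hess f x : 'M[R]_n := jacobian (grad f) x.

Definition C11 U f : Prop :=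
  (forall x, U x -> differentiable f x) /\
  exists K : R, forall x y, U x -> U y ->
    enorm (grad f x - grad f y) <= K * enorm (x - y).

(* eta is C^{1,1} away from a ball, so its Hessian exists almost everywhere and
   the bound on it is meant almost everywhere *)
Definition close_to_cone phi : Prop :=
  exists Gamma eta : 'rV[R]_n -> R,
  (forall (t : R) x, 0 < t -> Gamma (t *: x) = t * Gamma x) /\
  exists r C epsilon : R, 0 < epsilon < n%:R /\
  let D := [set x | r < enorm x] in
  [/\ forall x, D x -> phi x = Gamma x + eta x,
      C11 D eta,
      forall x, D x -> `|eta x| <= C * enorm x `^ (- epsilon),
      forall x, D x -> enorm (grad eta x) <= C * enorm x `^ (- 1 - epsilon) &
      {ae lebesgue_rV n, forall x, D x -> differentiable (grad eta) x /\
        enorm (hess eta x) <= C * enorm x `^ (- 2 - epsilon)} ].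

Definition delta u x y : R := u (x + y) + u (x - y) - 2 * u x.

Definition nonlocal_op F sigma w x : \bar R :=
  \int[lebesgue_rV n]_y (F (delta w x y) / enorm y `^ (n%:R + sigma))%:E.

Definition weighted_L1 sigma w : Prop :=
  (lebesgue_rV n).-integrable setT
    (fun y => (w y / (1 + enorm y) `^ (n%:R + sigma))%:E).

Definition lsc w : Prop := lower_semicontinuous (fun x => (w x)%:E).

Definition usc w : Prop := lower_semicontinuous (fun x => (- w x)%:E).

(* [patch w U eta] equals eta in U and w outside U; when touching from above
   (below) only the positive (negative) part of the integrand can fail to be
   integrable, so the extended-real integral is unambiguous *)
Definition visc_subsol F sigma Omega w f : Prop :=
  [/\ usc w, weighted_L1 sigma w &
      forall x, Omega x -> forall U (eta : 'rV[R]_n -> R),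
        open U -> U x -> C11 U eta -> eta x = w x ->
        (forall y, U y -> w y <= eta y) ->
        ((f x)%:E <= nonlocal_op F sigma (patch w U eta) x)%E ].

Definition visc_supersol F sigma Omega w f : Prop :=
  [/\ lsc w, weighted_L1 sigma w &
      forall x, Omega x -> forall U (eta : 'rV[R]_n -> R),
        open U -> U x -> C11 U eta -> eta x = w x ->
        (forall y, U y -> eta y <= w y) ->
        (nonlocal_op F sigma (patch w U eta) x <= (f x)%:E)%E ].

Definition visc_sol F sigma Omega w f : Prop :=
  visc_subsol F sigma Omega w f /\ visc_supersol F sigma Omega w f.

Definition vanishes_at_infinity w : Prop :=
  forall e : R, 0 < e -> exists r : R, forall x, r < enorm x -> `|w x| < e.

Definition superlinear (g : 'rV[R]_n -> R -> R) : Prop :=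
  forall K : set 'rV[R]_n, compact K ->
  forall M : R, \forall t \near +oo, forall x, K x -> M <= g x t / t.

End definitions.

(* Main.v *)
Require Import Defs.
From HB Require Import structures.
From mathcomp Require Import all_boot all_order all_algebra.
From mathcomp Require Import all_classical all_reals all_analysis.
From mathcomp Require Import measurable_realfun ring lra.
Set Implicit Arguments.
Unset Strict Implicit.
Unset Printing Implicit Defensive.
Import Order.TTheory GRing.Theory Num.Theory.
Import numFieldNormedType.Exports.
Local Open Scope classical_set_scope.
Local Open Scope ring_scope.

(** Everything rests on the comparison principle and on Perron's method; the
    integral equation enters only through the monotonicity of [F], its Lipschitz
    bound, and Fatou's lemma.

    Test functions are removed first. If [w] is touched from above at [x] by a
    paraboloid, testing with that paraboloid on shrinking balls shows that the
    integral of F(delta w(x, .)) against the kernel makes sense in [-oo, +oo[ and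
    is at least the right-hand side; conversely every C^{1,1} test function
    is bounded by a paraboloid near the contact point, and patching it in only
    increases the second differences. So sub- and supersolutions are
    characterized by an inequality for [w] itself at the points where it is
    touched ([visc_subsol_pointwise], [pointwise_visc_subsol]). All second
    differences that occur are bounded, on the side that matters, by a multiple of
    min(|y|^2, |y|), which is integrable against the kernel because
    1 < sigma < 2 ([integrable_growth_kernel]); this is the majorant in each use of
    Fatou's lemma ([second_order_integral_limsup]).

    Comparison ([comparison]) is then the doubling of variables: at a maximum of
    u(x) - v(y) - k |x - y|^2 the function [u] is touched from above, [v] from
    below, and delta u <= delta v, so the two inequalities can be chained. The
    maximum exists because [phi] is Lipschitz and, at infinity, u - phi is at most
    and v - phi at least 0 in the limit. Uniqueness is [visc_sol_le].

    For existence, the convex function [phi] is itself a subsolution, as its second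
    differences are nonnegative and g(x, 0) = 0. Since [phi] is close to a cone,
    the integral of delta phi(x, .) tends to 0 as [x] goes to infinity
    ([second_order_integral_obstacle_vanish]). From F(a + b) <= L (a + b^+) for
    a >= 0 and g(x, t) >= mu t for t >= 0 it follows that phi + psi is a
    supersolution as soon as L times the integral of delta phi + (delta psi)^+ is
    at most mu psi. For each e > 0 this is achieved by a small constant plus a high
    bump stretched so much that its own second differences contribute little
    ([barrier]); the barriers force the decay of subsolutions.

    The supremum of all subsolutions above [phi] with the right behaviour at
    infinity is, together with its upper semicontinuous envelope, such a
    subsolution ([perron_sup_class]). Its lower semicontinuous envelope is a
    supersolution, as otherwise the supremum could be raised near some point
    by a lifted paraboloid. Comparison makes the two envelopes equal, and
    [perron_solution] follows. *)

(** * Euclidean and sup norms *)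

Section euclidean.
Context {R : realType} {n : nat}.
Implicit Types x y z p : 'rV[R]_n.

Definition dot x y : R := \sum_i x ord0 i * y ord0 i.

Definition sqn x : R := dot x x.

Lemma dotDl x y z : dot (x + y) z = dot x z + dot y z.
Proof. by rewrite /dot -big_split; apply: eq_bigr => i _; rewrite mxE mulrDl. Qed.

Lemma dotC x y : dot x y = dot y x.
Proof. by apply: eq_bigr => i _; rewrite mulrC. Qed.

Lemma dotDr x y z : dot x (y + z) = dot x y + dot x z.
Proof. by rewrite dotC dotDl !(dotC x). Qed.

Lemma dotZl c x y : dot (c *: x) y = c * dot x y.
Proof. by rewrite /dot mulr_sumr; apply: eq_bigr => i _; rewrite mxE mulrA. Qed.

Lemma dotZr c x y : dot x (c *: y) = c * dot x y.
Proof. by rewrite dotC dotZl dotC. Qed.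

Lemma dotNl x y : dot (- x) y = - dot x y.
Proof. by rewrite -scaleN1r dotZl mulN1r. Qed.

Lemma dotNr x y : dot x (- y) = - dot x y.
Proof. by rewrite dotC dotNl dotC. Qed.

Lemma sqnD x y : sqn (x + y) = sqn x + 2 * dot x y + sqn y.
Proof. by rewrite /sqn dotDl !dotDr (dotC y x); ring. Qed.

Lemma sqnN x : sqn (- x) = sqn x.
Proof. by rewrite /sqn dotNl dotNr opprK. Qed.

Lemma sqnZ c x : sqn (c *: x) = c ^+ 2 * sqn x.
Proof. by rewrite /sqn dotZl dotZr; ring. Qed.

Lemma sqnB x y : sqn (x - y) = sqn x - 2 * dot x y + sqn y.
Proof. by rewrite sqnD sqnN dotNr; ring. Qed.

Lemma sqn0 : sqn 0 = 0.
Proof. by rewrite -(scale0r (0 : 'rV[R]_n)) sqnZ expr0n mul0r. Qed.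

Lemma dot0l x : dot 0 x = 0.
Proof. by rewrite -(scale0r (0 : 'rV[R]_n)) dotZl mul0r. Qed.

Lemma dot0r x : dot x 0 = 0.
Proof. by rewrite dotC dot0l. Qed.

Lemma sqn_ge0 x : 0 <= sqn x.
Proof. by apply: sumr_ge0 => i _; rewrite -expr2 sqr_ge0. Qed.

Lemma enorm_ge0 x : 0 <= enorm x.
Proof. exact: sqrtr_ge0. Qed.

Lemma enormE x : enorm x = Num.sqrt (sqn x).
Proof.
by rewrite /enorm big_ord1.
Qed.

Lemma sqr_enorm x : enorm x ^+ 2 = sqn x.
Proof. by rewrite enormE sqr_sqrtr ?sqn_ge0. Qed.

Lemma norm_coord_le x i : `|x ord0 i| <= `|x|.
Proof.
by rewrite [leRHS]mx_normrE (le_bigmax _ _ (ord0, i)).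
Qed.

Lemma norm_rV_le x c : 0 <= c -> (forall i, `|x ord0 i| <= c) -> `|x| <= c.
Proof.
move=> c0 xc; rewrite [leLHS]mx_normrE.
by apply: bigmax_le => // -[j i] _ /=; rewrite ord1.
Qed.

Lemma norm_rV_lt x c : 0 < c -> (forall i, `|x ord0 i| < c) -> `|x| < c.
Proof.
move=> c0 xc; rewrite [ltLHS]mx_normrE.
by apply: bigmax_lt => // -[j i] _ /=; rewrite ord1.
Qed.

Lemma sqr_norm_le_sqn x : `|x| ^+ 2 <= sqn x.
Proof.
rewrite -[leRHS]sqr_sqrtr ?sqn_ge0// ler_sqr ?nnegrE ?sqrtr_ge0//.
apply: norm_rV_le => [|i]; first exact: sqrtr_ge0.
rewrite -sqrtr_sqr ler_wsqrtr// /sqn /dot (bigD1 i)//= -expr2 lerDl.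
by apply: sumr_ge0 => j _; rewrite -expr2 sqr_ge0.
Qed.

Lemma dot_le x y : `|dot x y| <= n%:R * (`|x| * `|y|).
Proof.
rewrite (le_trans (ler_norm_sum _ _ _))//.
rewrite mulr_natl -[X in _ *+ X]card_ord -sumr_const; apply: ler_sum => i _.
by rewrite normrM ler_pM// norm_coord_le.
Qed.

Lemma sqn_le x : sqn x <= n%:R * `|x| ^+ 2.
Proof. by rewrite expr2 (le_trans _ (dot_le x x))// ler_norm. Qed.

Lemma norm_le_enorm x : `|x| <= enorm x.
Proof.
rewrite -ler_sqr ?nnegrE ?enorm_ge0//.
by rewrite sqr_enorm sqr_norm_le_sqn.
Qed.

Lemma enorm_le_norm x : enorm x <= n%:R * `|x|.
Proof.
rewrite -ler_sqr ?nnegrE ?enorm_ge0 ?mulr_ge0//.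
rewrite sqr_enorm (le_trans (sqn_le x))// exprMn ler_wpM2r ?sqr_ge0//.
have [->|n0] := posnP n; first by rewrite expr2 mulr0.
by rewrite -natrX ler_nat -mulnn leq_pmulr.
Qed.

Lemma enorm0 : enorm (0 : 'rV[R]_n) = 0.
Proof. by rewrite enormE sqn0 sqrtr0. Qed.

Lemma enorm_gt0 x : (0 < enorm x) = (x != 0).
Proof.
apply/idP/idP => [|x0]; first by apply: contraTneq => ->; rewrite enorm0 ltxx.
by rewrite (lt_le_trans _ (norm_le_enorm x)) ?normr_gt0.
Qed.

Lemma coord_cvg (i : 'I_n) : continuous (fun x => x ord0 i).
Proof. by move=> x; exact: coord_continuous. Qed.

Lemma continuous_sqn : continuous sqn.
Proof.
apply: (@continuous_big _ _ +%R 0 xpredT add_continuous 'rV[R]_n) => i _ x.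
by apply: (@cvgM _ 'rV[R]_n (nbhs x) _ (fun y => y ord0 i) (fun y => y ord0 i));
  exact: coord_cvg.
Qed.

Lemma continuous_enorm : continuous (fun x => enorm x).
Proof.
have -> : (fun x => enorm x) = Num.sqrt \o sqn.
  by apply/funext => x; exact: enormE.
by move=> x; apply: continuous_comp; [exact: continuous_sqn|exact: sqrt_continuous].
Qed.

End euclidean.

Section integral_monotone.
Context d (T : measurableType d) (R : realType).
Variable mu : {measure set T -> \bar R}.
Local Open Scope ereal_scope.

(** Read off the definition of the integral as a difference of two suprema over
    simple functions; this covers patches by arbitrary test functions. *)
Lemma le_integral_pointwise (f g : T -> \bar R) :
  (forall x, f x <= g x) -> \int[mu]_x f x <= \int[mu]_x g x.
Proof.
move=> fg; rewrite /integral !patch_setT.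
apply: leeB; apply: ereal_sup_le => _ [h /= hf <-].
- exists h => //= x.
  rewrite (le_trans (hf x))//; rewrite !funeposE.
  by rewrite ge_max !le_max (fg x) lexx !orbT.
- exists h => //= x.
  rewrite (le_trans (hf x))//; rewrite !funenegE.
  by rewrite ge_max !le_max leeN2 (fg x) lexx !orbT.
Qed.

End integral_monotone.

(** * Semicontinuous functions and measurability *)

Definition usc_real {R : realType} {T : topologicalType} (w : T -> R) :=
  forall x a, w x < a -> \forall y \near x, w y < a.

Section semicontinuity.
Context {R : realType} {T : topologicalType}.
Implicit Types (u v w : T -> R).

Lemma continuous_usc w : continuous w -> usc_real w.
Proof.
move=> cw x a wa.
have : \forall z \near w x, z < a by exact: lt_nbhsl.
exact: cw.
Qed.

Lemma usc_realD u v : usc_real u -> usc_real v -> usc_real (u \+ v).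
Proof.
move=> uu uv x a /= uva; pose e := (a - (u x + v x)) / 2.
have e0 : 0 < e by rewrite /e; lra.
near=> y.
have : u y < u x + e by near: y; apply: uu; lra.
have : v y < v x + e by near: y; apply: uv; lra.
by rewrite /e; lra.
Unshelve. all: by end_near. Qed.

Lemma usc_real_max u v : usc_real u -> usc_real v -> usc_real (u \max v).
Proof.
move=> uu uv x a /=; rewrite gt_max => /andP[ua va]; near=> y.
by rewrite /= gt_max; apply/andP; split; near: y; [exact: uu|exact: uv].
Unshelve. all: by end_near. Qed.

Lemma usc_real_comp (T' : topologicalType) (h : T' -> T) w : continuous h ->
  usc_real w -> usc_real (w \o h).
Proof. by move=> ch uw x a /= wa; exact: (ch x _ (uw _ _ wa)). Qed.

End semicontinuity.

Section borel.
Context {R : realType} {n : nat}.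
Implicit Types (x y : 'rV[R]_n) (U : set 'rV[R]_n) (w : 'rV[R]_n -> R).

Let coordR (i : 'I_n) : measurable_fun [set: 'rV[R]_n] (fun x => x ord0 i).
Proof. exact: measurable_coord. Qed.

Lemma measurable_cube (A : 'I_n -> set R) : (forall i, measurable (A i)) ->
  measurable [set x : 'rV[R]_n | forall i, A i (x ord0 i)].
Proof.
move=> mA.
rewrite (_ : mkset _ = \big[setI/setT]_(i < n)
     ((fun x : 'rV[R]_n => x ord0 i) @^-1` A i)).
  apply: bigsetI_measurable => i _; rewrite -[X in measurable X]setTI.
  exact: coordR.
rewrite -bigcap_seq; apply/seteqP; split => x /= Ax i.
  by move=> _; exact: Ax.
by apply: Ax; rewrite /= mem_index_enum.
Qed.

Lemma ball_cube x e : 0 < e ->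
  ball x e = [set y : 'rV[R]_n | forall i, ball (x ord0 i) e (y ord0 i)].
Proof.
move=> e0; apply/seteqP; split => y /=.
  rewrite -ball_normE /ball_/= => xy i.
  rewrite /ball/= (le_lt_trans _ xy)//.
  by rewrite -[X in X <= _](_ : `|(x - y) ord0 i| = _) ?norm_coord_le// !mxE.
move=> xy; rewrite -ball_normE /ball_/=; apply: norm_rV_lt => // i.
by rewrite !mxE; exact: xy.
Qed.

(** Open sets are Borel because the balls with rational centres and radii
    1 / k form a countable base. *)
Lemma open_measurable_rV U : open U -> measurable U.
Proof.
move=> oU.
pose B (p : 'rV[rat]_n * nat) : set 'rV[R]_n :=
  ball (\row_i ratr (p.1 ord0 i) : 'rV[R]_n) (p.2.+1%:R^-1).
have mB p : measurable (B p).
  rewrite /B ball_cube ?invr_gt0//.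
  apply: (@measurable_cube (fun i => ball ((\row_j ratr (p.1 ord0 j) : 'rV[R]_n) ord0 i) _)) => i.
  by apply: open_measurable; exact: ball_open.
pose C p := if `[< B p `<=` U >] then B p else set0.
have -> : U = \bigcup_p C p.
  apply/seteqP; split => [x Ux|x [k _]]; last first.
    by rewrite /C; case: asboolP => // + Bx; apply.
  have /nbhs_ballP[e /= e0 xeU] : nbhs x U by exact: open_nbhs_nbhs.
  have [k ke] : exists k : nat, k.+1%:R^-1 < e / 2.
    have e20 : 0 < e / 2 by lra.
    have [k _ /(_ _ (leqnn k)) ke] := near_infty_natSinv_lt (PosNum e20).
    by exists k.
  have k0 : 0 < k.+1%:R^-1 :> R by rewrite invr_gt0.
  have /choice[q qx] : forall i, exists q : rat, `|ratr q - x ord0 i| < k.+1%:R^-1.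
    move: (k.+1%:R^-1) k0 => r r0 i.
    have : x ord0 i - r < x ord0 i + r by lra.
    move=> /rat_in_itvoo[q]; rewrite in_itv/= => /andP[q1 q2]; exists q.
    by rewrite ltr_distl; apply/andP; split; lra.
  exists (\row_i q i, k) => //; rewrite /C.
  have Bx : B (\row_i q i, k) x.
    by rewrite /B ball_cube// => i; rewrite !mxE; exact: qx.
  case: asboolP => // -[]; apply: (subset_trans _ xeU) => y By.
  apply: (ball_split (z := \row_i ratr ((\row_i q i : 'rV[rat]_n) ord0 i) : 'rV[R]_n)).
    by apply: ball_sym; apply: le_ball Bx; exact: ltW.
  by apply: le_ball By; exact: ltW.
by apply: countable_bigcupT_measurable => // p; rewrite /C; case: asboolP.
Qed.

Lemma usc_realP w : usc w <-> usc_real w.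
Proof.
split=> [uw x a wa|uw x a].
  have /= := uw x (- a); rewrite lte_fin ltrN2 => /(_ wa)[V xV Va].
  apply: filterS xV => y Vy; have := Va _ Vy.
  by rewrite lte_fin ltrN2.
rewrite lte_fin ltrNr => /uw wa.
exists [set y | w y < - a] => // y/=.
by rewrite lte_fin ltrNr.
Qed.

Lemma lscP w : lsc w <-> usc_real (\- w).
Proof.
rewrite -usc_realP /lsc /usc.
by under [X in _ <-> lower_semicontinuous X]eq_fun do rewrite opprK.
Qed.

Lemma usc_open w a : usc_real w -> open [set x | w x < a].
Proof. by move=> uw; rewrite openE => x; exact: uw. Qed.

Lemma usc_measurable w : usc_real w -> measurable_fun setT w.
Proof.
move=> uw; apply: (measurability _ (RGenInftyO.measurableE R)).
move=> /= _ [_ [a ->]] <-; rewrite setTI; apply: open_measurable_rV.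
rewrite (_ : _ @^-1` _ = [set x | w x < a]); first exact: usc_open.
by apply/seteqP; split => x /=; rewrite in_itv.
Qed.

Lemma continuous_measurable_rV w : continuous w -> measurable_fun setT w.
Proof. by move=> /continuous_usc/usc_measurable. Qed.

Lemma measurable_translate (f : 'rV[R]_n -> R) x : measurable_fun setT f ->
  measurable_fun setT (fun y => f (x + y)).
Proof.
move=> mf; apply: (measurableT_comp mf); apply: measurable_fun_rV => i.
under eq_fun do rewrite mxE.
by apply: measurable_funD => //; exact: coordR.
Qed.

Lemma measurable_reflect (f : 'rV[R]_n -> R) x : measurable_fun setT f ->
  measurable_fun setT (fun y => f (x - y)).
Proof.
move=> mf; apply: (measurableT_comp mf); apply: measurable_fun_rV => i.
under eq_fun do rewrite !mxE.
by apply: measurable_funB => //; exact: coordR.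
Qed.

Lemma measurable_delta w x : measurable_fun setT w ->
  measurable_fun setT (delta w x).
Proof.
move=> mw; apply: measurable_funB => //; apply: measurable_funD.
  exact: measurable_translate.
exact: measurable_reflect.
Qed.

End borel.

(** * Integrability of the kernel *)

Lemma powR_lt1 (R : realType) (x p : R) : 0 <= x -> x < 1 -> 0 < p -> x `^ p < 1.
Proof.
move=> x0 x1 p0; have -> : 1 = 1 `^ p :> R by rewrite powR1.
by apply: gt0_ltr_powR; rewrite ?nnegrE.
Qed.

Lemma powR_exprn (R : realType) (x p : R) k : 0 <= x ->
  (x ^+ k) `^ p = (x `^ p) ^+ k.
Proof.
by move=> x0; rewrite -(powR_mulrn k x0) -powRrM mulrC powRrM powR_mulrn ?powR_ge0.
Qed.

Section kernel_integrability.
Context {R : realType} {n : nat}.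
Implicit Types (y : 'rV[R]_n) (t : R).
Local Notation leb := (lebesgue_rV (R := R) n).

Lemma lebesgue_rV_ball t : 0 < t ->
  leb (ball (0 : 'rV[R]_n) t) = ((2 * t) ^+ n)%:E.
Proof.
move=> t0; rewrite ball_cube//.
rewrite (lebesgue_rV_box (A := fun i => ball ((0 : 'rV[R]_n) ord0 i) t)); last first.
  by move=> i; apply: open_measurable; exact: ball_open.
under eq_bigr do rewrite lebesgue_measure_ball ?(ltW t0)//.
by rewrite prodEFin prodr_const card_ord mulr_natl.
Qed.

Lemma measurable_ball_rV (x : 'rV[R]_n) t : measurable (ball x t).
Proof.
have [t0|t0] := ltP 0 t; first by apply: open_measurable_rV; exact: ball_open.
rewrite (_ : ball x t = set0)//; apply/seteqP; split => // y.
by rewrite -ball_normE/= ltNge (le_trans t0).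
Qed.

(** A substitute for polar coordinates: a shell is contained in a ball, so a
    function that is at most [c k] on the [k]-th shell has finite integral once the
    masses of these balls, weighted by [c k], decrease geometrically. *)
Lemma integral_lt_pinfty_shells (f : 'rV[R]_n -> R) (t c : nat -> R) (C a : R) :
  measurable_fun setT f -> (forall y, 0 <= f y) ->
  (forall k, 0 < t k) -> (forall k, 0 <= c k) -> 0 < a < 1 -> 0 <= C ->
  (forall k, c k * (2 * t k) ^+ n <= C * a ^+ k) ->
  (forall y, 0 < f y -> exists k, `|y| < t k /\ f y <= c k) ->
  (\int[leb]_y (f y)%:E < +oo)%E.
Proof.
move=> mf f0 t0 c0 /andP[a0 a1] C0 ck fc.
pose h k y : \bar R := (c k * \1_(ball (0 : 'rV[R]_n) (t k)) y)%:E.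
have h0 k y : (0 <= h k y)%E by rewrite lee_fin mulr_ge0.
have mh k : measurable_fun setT (h k).
  rewrite /h; apply/measurable_EFinP; apply: measurable_funM => //.
  by apply: measurable_indic; exact: measurable_ball_rV.
have : (\int[leb]_y (f y)%:E <= \int[leb]_y \sum_(0 <= k <oo) h k y)%E.
  apply: le_integral_pointwise => y.
  have [fy|] := ltP 0 (f y); last first.
    move=> fy; apply: (@le_trans _ _ 0%E); first by rewrite lee_fin.
    exact: nneseries_ge0.
  have [k [yt fk]] := fc y fy.
  apply: (@le_trans _ _ (h k y)).
    rewrite /h lee_fin indicE mem_set ?mulr1//.
    by rewrite -ball_normE/= sub0r normrN.
  apply: (le_trans _ (nneseries_lim_ge k.+1 _)) => [|//].
  by rewrite big_nat_recr//= leeDr// sume_ge0.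
move=> /le_lt_trans; apply.
rewrite integral_nneseries//.
apply: (@le_lt_trans _ _ (C / (1 - a))%:E); last exact: ltry.
apply: lime_le; first by apply: is_cvg_nneseries => k _ _; exact: integral_ge0.
apply: nearW => N.
apply: (@le_trans _ _ (series (geometric C a) N)%:E); last first.
  rewrite lee_fin; have [->|Cn0] := eqVneq C 0.
    by rewrite mul0r /series/= big1// => i _; rewrite mul0r.
  by apply: geometric_le_lim => //; rewrite ger0_norm // ltW.
rewrite /series/= -sumEFin; apply: lee_sum => k _.
under eq_integral do rewrite /h.
rewrite (integralZl_indic _ (fun=> ball (0 : 'rV[R]_n) (t k)))//; first last.
- exact: measurable_ball_rV.
- by move=> ck0; move: (c0 k); rewrite leNgt ck0.
rewrite integral_indic//; last exact: measurable_ball_rV.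
by rewrite setIT/= lebesgue_rV_ball// -EFinM lee_fin.
Qed.

Variable sigma : R.
Hypothesis sigma_12 : 1 < sigma < 2.

(** The size of a second difference: quadratic near the origin under a one-sided
    C^{1,1} bound, linear at infinity for functions of linear growth. *)
Definition growth y : R := Num.min (`|y| ^+ 2) `|y|.

Definition kernel y : R := enorm y `^ (n%:R + sigma).

Lemma growth_ge0 y : 0 <= growth y.
Proof. by rewrite /growth le_min sqr_ge0 normr_ge0. Qed.

Lemma kernel_ge0 y : 0 <= kernel y.
Proof. exact: powR_ge0. Qed.

Lemma measurable_norm_rV : measurable_fun setT (fun y : 'rV[R]_n => `|y|).
Proof. by apply: continuous_measurable_rV => y; exact: norm_continuous. Qed.

Lemma measurable_growth : measurable_fun setT growth.
Proof.
apply: measurable_minr; last exact: measurable_norm_rV.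
by apply: measurable_funX; exact: measurable_norm_rV.
Qed.

Lemma measurable_kernelV : measurable_fun setT (fun y => (kernel y)^-1).
Proof.
under eq_fun do rewrite /kernel -powRN.
apply: (measurableT_comp (measurable_powR _)).
by apply: continuous_measurable_rV; exact: continuous_enorm.
Qed.

Let s0 : 0 < sigma. Proof. by case/andP: sigma_12 => *; lra. Qed.
Let p0 : 0 < n%:R + sigma. Proof. by rewrite ltr_wpDl. Qed.

Let growth_kernel_shell y t : 0 < t -> t / 4 <= `|y| -> `|y| < t ->
  growth y / kernel y <= Num.min (t ^+ 2) t / (t / 4) `^ (n%:R + sigma).
Proof.
move=> t0 ty yt; apply: ler_pM.
- exact: growth_ge0.
- by rewrite invr_ge0 kernel_ge0.
- rewrite /growth le_min !ge_min; apply/andP; split.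
    by rewrite ler_sqr ?nnegrE ?(ltW t0)// (ltW yt).
  by rewrite (ltW yt) orbT.
- rewrite lef_pV2 ?posrE; last 2 first.
  + rewrite powR_gt0// enorm_gt0 -normr_gt0 (lt_le_trans _ ty)//; lra.
  + by rewrite powR_gt0//; lra.
  apply: ge0_ler_powR; rewrite ?nnegrE ?enorm_ge0 ?(ltW p0)//; first lra.
  exact: le_trans ty (norm_le_enorm y).
Qed.

Let shell_mass t p : 0 < t -> Num.min (t ^+ 2) t <= t `^ p ->
  Num.min (t ^+ 2) t / (t / 4) `^ (n%:R + sigma) * (2 * t) ^+ n
    <= 8 ^+ n * 4 `^ sigma * t `^ (p - sigma).
Proof.
move=> t0 mp; have t40 : 0 < t / 4 by lra.
have t4n : t / 4 != 0 by rewrite gt_eqF.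
rewrite [(t / 4) `^ _]powRD ?t4n ?implybT// powR_mulrn ?(ltW t40)//.
have -> : (t / 4) `^ sigma = t `^ sigma / 4 `^ sigma.
  by rewrite powRM ?(ltW t0)// -[4^-1]powR_inv1// -powRrM mulN1r powRN.
rewrite [t `^ (p - sigma)]powRD ?(gt_eqF t0) ?implybT// powRN.
have tn : (t / 4) ^+ n != 0 by rewrite expf_neq0.
have -> : (2 * t) ^+ n = 8 ^+ n * (t / 4) ^+ n.
  by rewrite -exprMn; congr (_ ^+ n); field.
have ts : t `^ sigma != 0 by rewrite gt_eqF// powR_gt0.
have fs : 4 `^ sigma != 0 :> R by rewrite gt_eqF// powR_gt0.
rewrite [leLHS](_ : _ = 8 ^+ n * 4 `^ sigma * (Num.min (t ^+ 2) t / t `^ sigma)).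
  rewrite ler_wpM2l ?mulr_ge0 ?exprn_ge0 ?powR_ge0//.
  by rewrite ler_wpM2r// invr_ge0 powR_ge0.
by field; rewrite ts fs tn.
Qed.

Let dyadic t : 1 <= t -> exists k : nat, 2 ^+ k <= t < 2 ^+ k.+1.
Proof.
move=> t1; have ex : exists k, t < 2 ^+ k.
  have [k tk] : exists k : nat, t < k%:R.
    by exists (Num.bound t); apply: archi_boundP; lra.
  by exists k; rewrite (lt_trans tk)// -natrX ltr_nat ltn_expl.
case: (ex_minnP ex) => -[|k] tk kmin; first by move: tk; rewrite expr0; lra.
exists k; rewrite tk andbT leNgt; apply/negP => /kmin.
by rewrite ltnn.
Qed.

(** The shell of radius t has mass of order t^(2 - sigma) for small t and
    t^(1 - sigma) for large t, so both families of dyadic shells are summable. *)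
Lemma integrable_growth_kernel :
  leb.-integrable setT (fun y => (growth y / kernel y)%:E).
Proof.
have mg : measurable_fun setT (fun y => growth y / kernel y).
  by apply: measurable_funM; [exact: measurable_growth|exact: measurable_kernelV].
have g0 y : 0 <= growth y / kernel y.
  by rewrite divr_ge0 ?growth_ge0 ?kernel_ge0.
apply/integrableP; split; first exact/measurable_EFinP.
under eq_integral do rewrite gee0_abs ?lee_fin//.
have mA : measurable (ball (0 : 'rV[R]_n) 1) by exact: measurable_ball_rV.
rewrite -(setUv (ball (0 : 'rV[R]_n) 1)) ge0_integral_setU//=; last 4 first.
- exact: measurableC.
- by apply/measurable_EFinP; exact: measurable_funTS.
- by move=> y _; rewrite lee_fin.
- by rewrite disj_set2E setICr eqxx.
have [s1 s2] := andP sigma_12.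
rewrite lte_add_pinfty//.
- rewrite integral_mkcond.
  under eq_integral do rewrite restrict_EFin.
  (* the factor 2 leaves room for the shell [2^-(k+1), 2^-k] inside [t/4, t] *)
  pose t k : R := 2 * 2^-1 ^+ k.
  have t0 k : 0 < t k by rewrite mulr_gt0// exprn_gt0.
  apply: (@integral_lt_pinfty_shells _ t
    (fun k => Num.min (t k ^+ 2) (t k) / (t k / 4) `^ (n%:R + sigma))
    (8 ^+ n * 4 `^ sigma * 2 `^ (2 - sigma)) (2^-1 `^ (2 - sigma))) => //.
  + by apply/(measurable_restrictT _ mA); exact: measurable_funTS.
  + by move=> y; rewrite patchE; case: ifP.
  + by move=> k; rewrite divr_ge0 ?powR_ge0// le_min sqr_ge0 ltW.
  + rewrite powR_gt0//=.
    by apply: powR_lt1; lra.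
  + move=> k; apply: (le_trans (shell_mass (p := 2) (t0 k) _)).
      by rewrite powR_mulrn ?(ltW (t0 k))// ge_min lexx.
    rewrite -!mulrA ler_wpM2l ?exprn_ge0//ler_wpM2l ?powR_ge0//.
    by rewrite /t powRM ?exprn_ge0// powR_exprn.
  + move=> y; rewrite patchE; case: ifPn; last by rewrite ltxx.
    rewrite inE -ball_normE/= sub0r normrN => y1 gy.
    have y0 : 0 < `|y|.
      rewrite normr_gt0; apply: contraTneq gy => ->.
      by rewrite /growth normr0 expr2 mul0r minxx mul0r ltxx.
    have [|k /andP[ky yk]] := @dyadic (`|y|^-1); first by rewrite invf_ge1// ltW.
    have k0 : 0 < 2 ^+ k :> R by rewrite exprn_gt0.
    have {}ky : `|y| <= 2^-1 ^+ k by rewrite exprVn -[leLHS]invrK lef_pV2// posrE invr_gt0.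
    have {}yk : 2^-1 ^+ k.+1 < `|y|.
      by rewrite exprVn -[ltRHS]invrK ltf_pV2// posrE ?exprn_gt0// invr_gt0.
    move: yk; rewrite exprSr => yk.
    by exists k; split; [|apply: growth_kernel_shell] => //; rewrite /t; lra.
- rewrite integral_mkcond.
  under eq_integral do rewrite restrict_EFin.
  pose t k : R := 2 * 2 ^+ k.
  have t0 k : 0 < t k by rewrite mulr_gt0// exprn_gt0.
  apply: (@integral_lt_pinfty_shells _ t
    (fun k => Num.min (t k ^+ 2) (t k) / (t k / 4) `^ (n%:R + sigma))
    (8 ^+ n * 4 `^ sigma * 2 `^ (1 - sigma)) (2 `^ (1 - sigma))) => //.
  + by apply/(measurable_restrictT _ (measurableC mA)); exact: measurable_funTS.
  + by move=> y; rewrite patchE; case: ifP.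
  + by move=> k; rewrite divr_ge0 ?powR_ge0// le_min sqr_ge0 ltW.
  + rewrite powR_gt0//=.
    rewrite (_ : 1 - sigma = -1 * (sigma - 1)); last by ring.
    by rewrite powRrM powR_inv1//; apply: powR_lt1; lra.
  + move=> k; apply: (le_trans (shell_mass (p := 1) (t0 k) _)).
      by rewrite powRr1 ?(ltW (t0 k))// ge_min lexx orbT.
    rewrite -!mulrA ler_wpM2l ?exprn_ge0//ler_wpM2l ?powR_ge0//.
    by rewrite /t powRM ?exprn_ge0// powR_exprn.
  + move=> y; rewrite patchE; case: ifPn; last by rewrite ltxx.
    rewrite inE /= -ball_normE/= sub0r normrN => /negP; rewrite -leNgt => y1 gy.
    have [k /andP[ky]] := dyadic y1; rewrite exprSr => yk.
    have k0 : 0 < 2 ^+ k :> R by rewrite exprn_gt0.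
    by exists k; split; [|apply: growth_kernel_shell] => //; rewrite /t; lra.
Qed.

Lemma integrable_weight :
  leb.-integrable setT
    (fun y => ((1 + `|y|) / (1 + enorm y) `^ (n%:R + sigma))%:E).
Proof.
have mw : measurable_fun setT
    (fun y : 'rV[R]_n => (1 + `|y|) / (1 + enorm y) `^ (n%:R + sigma)).
  apply: measurable_funM.
    by apply: measurable_funD => //; exact: measurable_norm_rV.
  under eq_fun do rewrite -powRN.
  apply: (measurableT_comp (measurable_powR _)).
  apply: measurable_funD => //.
  by apply: continuous_measurable_rV; exact: continuous_enorm.
have mB : measurable (ball (0 : 'rV[R]_n) 1) by exact: measurable_ball_rV.
apply: (@le_integrable _ _ _ leb _ measurableT _
  (fun y => (2 * \1_(ball (0 : 'rV[R]_n) 1) y)%:E + (2 * (growth y / kernel y))%:E)%E).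
- exact/measurable_EFinP.
- move=> y _; rewrite -EFinD !abse_EFin lee_fin.
  have g0 : 0 <= growth y / kernel y by rewrite divr_ge0 ?growth_ge0 ?kernel_ge0.
  have e0 := enorm_ge0 y; have ye := norm_le_enorm y.
  have y0 := normr_ge0 y.
  rewrite ger0_norm; last by rewrite divr_ge0 ?powR_ge0//; lra.
  rewrite ger0_norm; last by apply: addr_ge0; apply: mulr_ge0.
  have w1 : 1 <= (1 + enorm y) `^ (n%:R + sigma).
    apply: (@le_trans _ _ (1 `^ (n%:R + sigma))); first by rewrite powR1.
    by apply: ge0_ler_powR; rewrite ?nnegrE ?(ltW p0)//; lra.
  have [y1|y1] := ltP `|y| 1.
    rewrite indicE mem_set/= ?mulr1; last by rewrite -ball_normE/= sub0r normrN.
    apply: ler_wpDr; first exact: mulr_ge0.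
    by rewrite ler_pdivrMr ?(lt_le_trans _ w1)//; nra.
  apply: ler_wpDl; first exact: mulr_ge0.
  rewrite mulrA; apply: ler_pM; first lra.
  + by rewrite invr_ge0 powR_ge0.
  + rewrite /growth (_ : Num.min _ _ = `|y|); first lra.
    by apply/min_idPr; rewrite expr2 ler_peMr.
  + rewrite lef_pV2 ?posrE ?(lt_le_trans _ w1)//; last first.
      by rewrite powR_gt0//; lra.
    by apply: ge0_ler_powR; rewrite ?nnegrE ?(ltW p0)//; lra.
- apply: integrableD => //.
    apply: (@eq_integrable _ _ _ _ _ measurableT
      (fun y => 2%:E * (\1_(ball (0 : 'rV[R]_n) 1) y)%:E)%E).
      by move=> y _; rewrite EFinM.
    apply: integrableZl => //.
    apply/integrableP; split; first exact/measurable_EFinP/measurable_indic.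
    under eq_integral do rewrite gee0_abs ?lee_fin//.
    by rewrite integral_indic// setIT/= lebesgue_rV_ball// ltry.
  apply: (@eq_integrable _ _ _ _ _ measurableT
      (fun y => 2%:E * (growth y / kernel y)%:E)%E).
    by move=> y _; rewrite -EFinM.
  by apply: integrableZl => //; exact: integrable_growth_kernel.
Qed.

End kernel_integrability.

(** * Fatou's lemma for the nonlocal integral *)

Section integral_of_difference.
Context d (T : measurableType d) (R : realType).
Variable mu : {measure set T -> \bar R}.
Variables (H f : T -> R) (c : R).
Hypotheses (H0 : forall x, 0 <= H x) (iH : mu.-integrable setT (EFin \o H)).
Hypotheses (mf : measurable_fun setT f) (fH : forall x, f x <= H x).

Let mH : measurable_fun setT H.
Proof. by apply/measurable_EFinP; exact: measurable_int iH. Qed.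

Lemma integral_fin_num_dominator : (\int[mu]_x (H x)%:E \is a fin_num)%E.
Proof. exact: integrable_fin_num. Qed.

(** For a measurable [f] bounded above by an integrable [H] the integral of [f]
    makes sense in [-oo, +oo[, and lower bounds for it are upper bounds for the
    integral of the nonnegative function [H - f]. *)
Lemma le_integral_dominated :
  (c%:E <= \int[mu]_x (f x)%:E)%E <->
  (\int[mu]_x (H x - f x)%:E <= \int[mu]_x (H x)%:E - c%:E)%E.
Proof.
pose fp x := Num.max (f x) 0; pose fn x := Num.max (- f x) 0.
have mfp : measurable_fun setT fp by exact: measurable_maxr.
have mfn : measurable_fun setT fn.
  by apply: measurable_maxr => //; exact: measurableT_comp.
have fp0 x : 0 <= fp x by rewrite le_max lexx orbT.
have fn0 x : 0 <= fn x by rewrite le_max lexx orbT.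
have mHf : measurable_fun setT (H \- f) by exact: measurable_funB.
have Hf0 x : 0 <= H x - f x by rewrite subr_ge0.
have pn : (\int[mu]_x (f x)%:E = \int[mu]_x (fp x)%:E - \int[mu]_x (fn x)%:E)%E.
  by rewrite integralE; congr (_ - _)%E; apply: eq_integral => x _;
    rewrite ?funeposE ?funenegE -?EFinN -EFin_max.
have : (\int[mu]_x (H x - f x)%:E + \int[mu]_x (fp x)%:E =
        \int[mu]_x (H x)%:E + \int[mu]_x (fn x)%:E)%E.
  rewrite -!ge0_integralD//; try by [move=> x _; rewrite lee_fin | exact/measurable_EFinP].
  apply: eq_integral => x _; rewrite -!EFinD; congr EFin.
  rewrite /fp /fn /Num.max.
  by case: (ltP (f x) 0) => ?; case: (ltP (- f x) 0) => ?; lra.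
have fpfin : (\int[mu]_x (fp x)%:E \is a fin_num)%E.
  rewrite ge0_fin_numE; last by apply: integral_ge0 => x _; rewrite lee_fin.
  rewrite (@le_lt_trans _ _ (\int[mu]_x (H x)%:E)%E)//.
    apply: le_integral_pointwise => x.
    by rewrite lee_fin ge_max fH H0.
  by move: integral_fin_num_dominator; rewrite fin_numElt => /andP[].
move: integral_fin_num_dominator fpfin; rewrite pn.
have : (0 <= \int[mu]_x (fn x)%:E)%E by apply: integral_ge0 => x _; rewrite lee_fin.
have : (0 <= \int[mu]_x (H x - f x)%:E)%E by apply: integral_ge0 => x _; rewrite lee_fin.
case: (\int[mu]_x (H x)%:E)%E => [a| |] //.
case: (\int[mu]_x (fp x)%:E)%E => [b| |] //.
case: (\int[mu]_x (H x - f x)%:E)%E => [h| |] //;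
  case: (\int[mu]_x (fn x)%:E)%E => [k| |] // _ _ _ _.
by move=> [hk]; rewrite -!EFinD !lee_fin; split; lra.
Qed.

End integral_of_difference.

Lemma limn_einf_le (R : realType) (u v : (\bar R)^nat) (l : \bar R) :
  (forall k, u k <= v k)%E -> v @ \oo --> l -> (limn_einf u <= l)%E.
Proof.
move=> uv vl; rewrite limn_einf_lim -(cvg_lim _ vl)//.
apply: lee_lim; [exact: is_cvg_einfs|by apply/cvg_ex; exists l|].
apply: nearW => k; apply: le_trans (uv k).
by apply: ereal_inf_lbound; exists k => /=.
Qed.

Section nonlocal_integral.
Context {R : realType} {n : nat}.
Variables (sigma : R) (F : R -> R) (L : R).
Hypothesis sigma_12 : 1 < sigma < 2.
Hypotheses (F_incr : {homo F : s t / s <= t}) (F_0 : F 0 = 0).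
Hypothesis F_lip : forall s t, `|F s - F t| <= L * `|s - t|.
Implicit Types (d : 'rV[R]_n -> R) (x y : 'rV[R]_n).
Local Notation leb := (lebesgue_rV (R := R) n).

(** The nonlocal operator as a function of the second difference [d] alone. *)
Definition second_order_integral (F : R -> R) d : \bar R :=
  \int[leb]_y (F (d y) / kernel sigma y)%:E.

Local Notation J := second_order_integral.

Lemma le_second_order_integral d d' : (forall y, d y <= d' y) ->
  (J F d <= J F d')%E.
Proof.
move=> dd'; apply: le_integral_pointwise => y.
by rewrite lee_fin ler_wpM2r ?invr_ge0 ?kernel_ge0// F_incr.
Qed.

Let L0 : 0 <= L.
Proof. by have := F_lip 1 0; rewrite subr0 normr1 mulr1; exact: le_trans. Qed.

Lemma lip_continuous : continuous F.
Proof.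
move=> t; apply/cvgrPdist_le => e e0.
near=> s; apply: (le_trans (F_lip t s)).
rewrite (@le_trans _ _ ((L + 1) * `|t - s|))//.
  by rewrite ler_wpM2r// lerDl.
rewrite -ler_pdivlMl ?ltr_wpDl//.
near: s; apply: cvgr_dist_le; first exact: cvg_id.
by rewrite mulr_gt0// invr_gt0 ltr_wpDl.
Unshelve. all: by end_near. Qed.

Lemma measurable_integrand d : measurable_fun setT d ->
  measurable_fun setT (fun y => F (d y) / kernel sigma y).
Proof.
move=> md; apply: measurable_funM; last exact: measurable_kernelV.
apply: (measurableT_comp _ md); apply: continuous_measurable_fun.
exact: lip_continuous.
Qed.

Let H C y := L * C * (growth y / kernel sigma y).

Let H_ge0 C y : 0 <= C -> 0 <= H C y.
Proof.
by move=> C0; rewrite mulr_ge0 ?(mulr_ge0 L0)// divr_ge0 ?growth_ge0 ?kernel_ge0.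
Qed.

Let integrableH C : leb.-integrable setT (EFin \o H C).
Proof.
apply: (@eq_integrable _ _ _ _ _ measurableT
      (fun y => (L * C)%:E * (growth y / kernel sigma y)%:E)%E).
  by move=> y _; rewrite -EFinM.
by apply: integrableZl => //; exact: integrable_growth_kernel.
Qed.

Let le_H C d y : 0 <= C -> d y <= C * growth y -> F (d y) / kernel sigma y <= H C y.
Proof.
move=> C0 dC; rewrite /H mulrA ler_wpM2r ?invr_ge0 ?kernel_ge0//.
apply: (le_trans (F_incr dC)).
have := F_lip (C * growth y) 0; rewrite F_0 !subr0.
move=> /(le_trans (ler_norm _)) => /le_trans; apply.
by rewrite ger0_norm ?mulr_ge0 ?growth_ge0// mulrA.
Qed.

(** Fatou's lemma, used from above: second differences that stay below a fixed
    multiple of the integrable profile [growth] can only gain integral in the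
    upper limit. *)
Lemma second_order_integral_limsup (d_ : nat -> 'rV[R]_n -> R) d (c : nat -> R)
    (c0 C : R) :
  0 <= C -> (forall k, measurable_fun setT (d_ k)) -> measurable_fun setT d ->
  (forall k y, d_ k y <= C * growth y) ->
  (forall y e, 0 < e -> \forall k \near \oo, d_ k y <= d y + e) ->
  c @ \oo --> c0 ->
  (forall k, ((c k)%:E <= J F (d_ k))%E) ->
  (c0%:E <= J F d)%E.
Proof.
move=> C0 md_ md d_C d_d cc0 cJ.
wlog dC : d md d_d / forall y, d y <= C * growth y.
  move=> hd; apply: (@le_trans _ _ (J F (fun y => Num.min (d y) (C * growth y)))).
    apply: hd => [|y e e0|y].
    - apply: measurable_minr => //; apply: measurable_funM => //.
      exact: measurable_growth.
    - near=> k; rewrite addr_minl le_min; apply/andP; split.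
        by near: k; exact: d_d.
      by rewrite (le_trans (d_C k y))// lerDl ltW.
    - by rewrite ge_min lexx orbT.
  by apply: le_second_order_integral => y; rewrite ge_min lexx.
(* the maximum with [d] turns the one-sided condition into convergence *)
pose m_ k y := Num.max (d_ k y) (d y).
have mm k : measurable_fun setT (m_ k) by exact: measurable_maxr.
have mC k y : m_ k y <= C * growth y by rewrite ge_max d_C dC.
have mJ k : ((c k)%:E <= J F (m_ k))%E.
  apply: (le_trans (cJ k)); apply: le_second_order_integral => y.
  by rewrite le_max lexx.
have m_d y : m_ ^~ y @ \oo --> d y.
  apply/cvgrPdist_le => e e0; near=> k.
  have : d_ k y <= d y + e by near: k; exact: d_d.
  by rewrite /m_ /Num.max; case: ltP => dd de; rewrite ?subrr ?normr0 ?(ltW e0)//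
    ler_distl; apply/andP; split; lra.
have HC0 y : 0 <= H C y by exact: H_ge0.
apply: (proj2 (le_integral_dominated c0 HC0 (integrableH C)
  (measurable_integrand md) (fun y => le_H C0 (dC y)))).
pose h k y : \bar R := (H C y - F (m_ k y) / kernel sigma y)%:E.
have mh k : measurable_fun setT (h k).
  rewrite /h; apply/measurable_EFinP; apply: measurable_funB.
    by apply/measurable_EFinP; exact: measurable_int (integrableH C).
  exact: measurable_integrand.
have h0 k y : (0 <= h k y)%E by rewrite lee_fin subr_ge0 le_H.
have := fatou leb measurableT mh (fun k y _ => h0 k y).
rewrite (_ : (fun y => limn_einf (h ^~ y)) =
    fun y => (H C y - F (d y) / kernel sigma y)%:E); last first.
  apply/funext => y; apply: (cvg_limn_einf_sup _).1.
  apply: cvg_EFin; first exact: nearW.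
  apply: cvgB; first exact: cvg_cst.
  apply: cvgM; last exact: cvg_cst.
  apply: continuous_cvg; [exact: lip_continuous|exact: m_d].
move=> /le_trans; apply.
apply: (@limn_einf_le _ _ (fun k => \int[leb]_y (H C y)%:E - (c k)%:E)%E).
  move=> k; apply: (proj1 (le_integral_dominated (c k) HC0 (integrableH C)
    (measurable_integrand (mm k)) (fun y => le_H C0 (mC k y)))).
  exact: mJ.
have := integral_fin_num_dominator (integrableH C).
case: (\int[leb]_y (H C y)%:E)%E => // a _.
rewrite -EFinB; apply: cvg_EFin; first exact: nearW.
by apply: cvgB => //; exact: cvg_cst.
Unshelve. all: by end_near. Qed.

End nonlocal_integral.

(** * Taylor expansions and paraboloids *)

Section calculus.
Context {R : realType} {n : nat}.
Implicit Types (x y z p : 'rV[R]_n) (f : 'rV[R]_n -> R) (U : set 'rV[R]_n).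

Lemma derive_dot f z y : differentiable f z -> 'D_y f z = dot (grad f z) y.
Proof.
move=> df; rewrite deriveE// [y in LHS]row_sum_delta linear_sum.
by apply: eq_bigr => i _; rewrite linearZ mxE deriveE// mulrC.
Qed.

Lemma is_derive_line f x y (t : R) : differentiable f (x + t *: y) ->
  is_derive t (1 : R) (fun s : R => f (x + s *: y)) (dot (grad f (x + t *: y)) y).
Proof.
move=> df; have e : (fun s : R => s^-1 *: (((fun s : R => f (x + s *: y)) \o shift t) (s *: 1)
    - f (x + t *: y))) =
    (fun s : R => s^-1 *: ((f \o shift (x + t *: y)) (s *: y) - f (x + t *: y))).
  apply/funext => s /=; congr (_ *: (f _ - _)).
  rewrite (_ : s *: (1 : R) = s); first by rewrite scalerDl addrCA.
  by rewrite /GRing.scale/= mulr1.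
by apply: DeriveDef; [rewrite /derivable e; exact: diff_derivable
  | rewrite /derive e -derive_dot].
Qed.

(** The mean value theorem along the segment from [x] to [x + y] turns the
    Lipschitz bound on the gradient into a quadratic Taylor remainder. *)
Lemma C11_taylor U f : C11 U f -> exists2 K, 0 <= K & forall x y,
  (forall t, 0 <= t <= 1 -> U (x + t *: y)) ->
  `|f (x + y) - f x - dot (grad f x) y| <= K * `|y| ^+ 2.
Proof.
move=> [df [K gK]]; exists (n%:R * (`|K| * n%:R)); first by rewrite !mulr_ge0.
move=> x y Uxy.
pose h (s : R) := f (x + s *: y).
have dh (t : R) : 0 <= t <= 1 -> is_derive t (1 : R) h (dot (grad f (x + t *: y)) y).
  by move=> t01; apply: is_derive_line; apply: df; exact: Uxy.
have [|||c + hc] := @MVT_segment R h (fun t => dot (grad f (x + t *: y)) y) 0 1.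
- exact: ler01.
- by move=> t; rewrite in_itv/= => /andP[t0 t1]; apply: dh; rewrite !ltW.
- apply: derivable_within_continuous => t; rewrite in_itv/= => t01.
  by have := dh _ t01 => -[].
rewrite in_itv/= => c01.
move: hc; rewrite /h scale1r scale0r addr0 subr0 mulr1 => ->.
rewrite -dotNl -dotDl (le_trans (dot_le _ _))//.
rewrite -!mulrA ler_wpM2l// expr2 !mulrA ler_wpM2r//.
rewrite (le_trans (norm_le_enorm _))//.
have [c0 c1] := andP c01.
have U0 : U x by have := Uxy 0; rewrite scale0r addr0; apply; rewrite lexx ler01.
rewrite (le_trans (gK _ _ (Uxy _ c01) U0))//.
rewrite addrAC subrr add0r -mulrA.
apply: (@le_trans _ _ (`|K| * enorm (c *: y))).
  by rewrite ler_wpM2r ?enorm_ge0// ler_norm.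
rewrite ler_wpM2l// (le_trans (enorm_le_norm _))// ler_wpM2l// normrZ ger0_norm//.
by rewrite ler_piMl.
Qed.

Definition paraboloid (a : R) x p (K : R) z : R :=
  a + dot p (z - x) + K * sqn (z - x).

Lemma paraboloidD a x p K z y :
  paraboloid a x p K (z + y) =
  paraboloid a x p K z + dot (p + (2 * K) *: (z - x)) y + K * sqn y.
Proof.
rewrite /paraboloid (_ : z + y - x = (z - x) + y); last by rewrite addrAC.
by move: (z - x) => w; rewrite sqnD dotDr dotDl dotZl; ring.
Qed.

Lemma differentiable_paraboloid a x p K z :
  differentiable (paraboloid a x p K) z.
Proof.
have dc i : differentiable (fun z : 'rV[R]_n => (z - x) ord0 i) z.
  rewrite (_ : (fun z => _) = (fun z : 'rV[R]_n => z ord0 i) - cst (x ord0 i)).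
    by apply: differentiableB; [exact: differentiable_coord|exact: differentiable_cst].
  by apply/funext => u; rewrite !mxE.
rewrite (_ : paraboloid _ _ _ _ = cst a
  + \sum_i (cst (p ord0 i) * (fun z : 'rV[R]_n => (z - x) ord0 i))
  + cst K * \sum_i ((fun z : 'rV[R]_n => (z - x) ord0 i) * (fun z => (z - x) ord0 i))).
  apply: differentiableD.
    apply: differentiableD; first exact: differentiable_cst.
    apply: differentiable_sum => i; apply: differentiableM => //.
  apply: differentiableM; first exact: differentiable_cst.
  by apply: differentiable_sum => i; exact: differentiableM.
by apply/funext => u; rewrite !fctE !fct_sumE.
Qed.

Lemma grad_paraboloid a x p K z :
  grad (paraboloid a x p K) z = p + (2 * K) *: (z - x).
Proof.
apply/rowP => i; rewrite mxE; apply: cvg_lim => //.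
set v := delta_mx ord0 i.
have -> : (p + (2 * K) *: (z - x)) ord0 i = dot (p + (2 * K) *: (z - x)) v + 0 * (K * sqn v).
  rewrite mul0r addr0 /dot (bigD1 i)//= big1 ?addr0; last first.
    by move=> j ji; rewrite [v _ _]mxE eqxx/= (negbTE ji) mulr0.
  by rewrite [v _ _]mxE !eqxx mulr1.
have lim : (fun h : R => dot (p + (2 * K) *: (z - x)) v + h * (K * sqn v)) @ 0^' -->
    dot (p + (2 * K) *: (z - x)) v + 0 * (K * sqn v).
  apply: cvgD; first exact: cvg_cst.
  apply: cvgM; last exact: cvg_cst.
  by apply: cvg_within.
apply: cvg_trans lim; apply: near_eq_cvg.
near=> h; have h0 : h != 0 by near: h; exact: nbhs_dnbhs_neq.
rewrite /= [_ + z]addrC paraboloidD sqnZ dotZr /GRing.scale/=.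
by field.
Unshelve. all: by end_near. Qed.

Lemma C11_paraboloid U a x p K : C11 U (paraboloid a x p K).
Proof.
split=> [z _|]; first exact: differentiable_paraboloid.
exists (2 * `|K|) => y z _ _.
rewrite !grad_paraboloid [X in enorm X](_ : _ = (2 * K) *: (y - z)).
  rewrite enormE sqnZ sqrtrM ?sqr_ge0// sqrtr_sqr -enormE.
  by rewrite normrM ger0_norm.
by apply/rowP => i; rewrite !mxE; ring.
Qed.

Lemma continuous_paraboloid a x p K : continuous (paraboloid a x p K).
Proof.
by move=> z; apply: differentiable_continuous; exact: differentiable_paraboloid.
Qed.

End calculus.

(** * Reflection, and bounds on second differences *)

(** If [w] is a supersolution for [F] then [- w] is a subsolution for the odd
    reflection of [F], so bounds from above yield bounds from below. *)
Definition odd_reflection (R : realType) (F : R -> R) (t : R) : R := - F (- t).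

Section reflection.
Context {R : realType} {n : nat}.
Variables (sigma : R) (F : R -> R) (L : R).
Hypothesis sigma_12 : 1 < sigma < 2.
Hypotheses (F_incr : {homo F : s t / s <= t}) (F_0 : F 0 = 0).
Hypothesis F_lip : forall s t, `|F s - F t| <= L * `|s - t|.
Implicit Types (d : 'rV[R]_n -> R).
Local Notation leb := (lebesgue_rV (R := R) n).
Local Notation J := (second_order_integral sigma).
Local Notation Fr := (odd_reflection F).

Lemma odd_reflection_incr : {homo Fr : s t / s <= t}.
Proof. by move=> s t st; rewrite /odd_reflection lerN2 F_incr// lerN2. Qed.

Lemma odd_reflection0 : Fr 0 = 0.
Proof. by rewrite /odd_reflection oppr0 F_0 oppr0. Qed.

Lemma odd_reflection_lip s t : `|Fr s - Fr t| <= L * `|s - t|.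
Proof.
rewrite /odd_reflection -opprD normrN (le_trans (F_lip _ _))//.
by rewrite -opprD normrN.
Qed.

Let Jpn (G : R -> R) d : (J G d =
  \int[leb]_y (Num.max (G (d y) / kernel sigma y) 0)%:E -
  \int[leb]_y (Num.max (- (G (d y) / kernel sigma y)) 0)%:E)%E.
Proof.
rewrite /second_order_integral integralE; congr (_ - _)%E; apply: eq_integral => x _;
    by rewrite ?funeposE ?funenegE -?EFinN -EFin_max.
Qed.

Let int_max0_ge0 (f : 'rV[R]_n -> R) : (0 <= \int[leb]_y (Num.max (f y) 0)%:E)%E.
Proof. by apply: integral_ge0 => y _; rewrite lee_fin le_max lexx orbT. Qed.

Let Jr d : (J Fr (\- d)%R =
  \int[leb]_y (Num.max (- (F (d y) / kernel sigma y)) 0)%:E -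
  \int[leb]_y (Num.max (F (d y) / kernel sigma y) 0)%:E)%E.
Proof.
rewrite Jpn; congr (_ - _)%E; apply: eq_integral => y _;
  by rewrite /odd_reflection opprK mulNr ?opprK.
Qed.

(** Only an inequality, because an integral of the form oo - oo has value -oo
    by convention, on both sides of the reflection. *)
Lemma second_order_integral_reflection_le d : (J Fr (\- d)%R <= - J F d)%E.
Proof.
rewrite Jr Jpn; set a := (\int[leb]_y _)%E; set b := (\int[leb]_y _)%E.
have : (0 <= a)%E by exact: int_max0_ge0.
have : (0 <= b)%E by exact: int_max0_ge0.
case: a => [a| |] //; case: b => [b| |] // _ _.
by rewrite -!EFinD -EFinN lee_fin; lra.
Qed.

Lemma second_order_integral_reflection d C : measurable_fun setT d -> 0 <= C ->
  (forall y, - d y <= C * growth y) -> J Fr (\- d)%R = (- J F d)%E.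
Proof.
move=> md C0 dC; rewrite Jr Jpn.
set a := (\int[leb]_y _)%E; set b := (\int[leb]_y _)%E.
suff : a \is a fin_num.
  have : (0 <= b)%E by exact: int_max0_ge0.
  case: a => [a| |] //; case: b => [b| |] // _ _.
  by rewrite -!EFinD -EFinN opprB.
rewrite ge0_fin_numE; last exact: int_max0_ge0.
apply: (@le_lt_trans _ _ (\int[leb]_y ((L * C)%:E * (growth y / kernel sigma y)%:E))%E).
  apply: le_integral_pointwise => y; rewrite -EFinM lee_fin ge_max.
  have L0 : 0 <= L by have := F_lip 1 0; rewrite subr0 normr1 mulr1; exact: le_trans.
  rewrite mulr_ge0 ?divr_ge0 ?growth_ge0 ?kernel_ge0 ?(mulr_ge0 L0)// andbT.
  rewrite -mulNr mulrA ler_wpM2r ?invr_ge0 ?kernel_ge0//.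
  have [d0|d0] := leP 0 (d y).
    rewrite (@le_trans _ _ 0) ?mulr_ge0 ?growth_ge0// oppr_le0 -F_0.
    exact: F_incr.
  rewrite -sub0r -F_0 (le_trans (ler_norm _))// (le_trans (F_lip _ _))//.
  by rewrite sub0r normrN ltr0_norm// -mulrA ler_wpM2l.
have /integrableP[_] : leb.-integrable setT
    (fun y => (L * C)%:E * (growth y / kernel sigma y)%:E)%E.
  by apply: integrableZl => //; exact: integrable_growth_kernel.
apply: le_lt_trans; apply: le_integral_pointwise => y.
by rewrite -EFinM abse_EFin lee_fin ler_norm.
Qed.

End reflection.

Section fatou_below.
Context {R : realType} {n : nat}.
Variables (sigma : R) (F : R -> R) (L : R).
Hypothesis sigma_12 : 1 < sigma < 2.
Hypotheses (F_incr : {homo F : s t / s <= t}) (F_0 : F 0 = 0).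
Hypothesis F_lip : forall s t, `|F s - F t| <= L * `|s - t|.
Implicit Types (d : 'rV[R]_n -> R).
Local Notation J := (second_order_integral sigma).

Lemma second_order_integral_liminf (d_ : nat -> 'rV[R]_n -> R) d (c : nat -> R)
    (c0 C : R) :
  0 <= C -> (forall k, measurable_fun setT (d_ k)) -> measurable_fun setT d ->
  (forall k y, - d_ k y <= C * growth y) ->
  (forall y e, 0 < e -> \forall k \near \oo, d y <= d_ k y + e) ->
  c @ \oo --> c0 ->
  (forall k, (J F (d_ k) <= (c k)%:E)%E) ->
  (J F d <= c0%:E)%E.
Proof.
move=> C0 md_ md d_C d_d cc0 cJ.
rewrite -leeN2; apply: (le_trans _ (second_order_integral_reflection_le _ _ _)).
rewrite -EFinN.
apply: (second_order_integral_limsup sigma_12 (odd_reflection_incr F_incr)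
  (odd_reflection0 F_0) (odd_reflection_lip F_lip) (d_ := fun k => \- d_ k)
  (c := fun k => - c k) C0 _ _ d_C).
- by move=> k; exact: measurable_funN.
- exact: measurable_funN.
- move=> y e e0; near=> k.
  rewrite -lerBlDr -opprD lerN2; near: k; exact: d_d.
- exact: cvgN.
- move=> k; rewrite (second_order_integral_reflection sigma_12 F_incr F_0 F_lip (md_ k) C0)//.
  by rewrite EFinN leeN2.
Unshelve. all: by end_near. Qed.

End fatou_below.

Section pointwise_criterion.
Context {R : realType} {n : nat}.
Implicit Types (x y z p : 'rV[R]_n) (w f : 'rV[R]_n -> R).

Lemma le_growth (A B r : R) : 0 <= A -> 0 <= B -> 0 < r ->
  exists2 C, 0 <= C & forall (d : 'rV[R]_n -> R),
    (forall y, `|y| < r -> d y <= A * `|y| ^+ 2) ->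
    (forall y, r <= `|y| -> d y <= B * (1 + `|y|)) ->
    forall y, d y <= C * growth y.
Proof.
move=> A0 B0 r0; have rV0 : 0 <= r^-1 ^+ 2 by exact: sqr_ge0.
exists (A * (1 + r) + 2 * B * (1 + r^-1 ^+ 2)).
  by apply: addr_ge0; apply: mulr_ge0; lra.
move=> d dA dB y; have N0 := normr_ge0 y.
have g0 := growth_ge0 y.
have rr : r^-1 ^+ 2 * r ^+ 2 = 1 by rewrite -exprMn mulVf ?expr1n// gt_eqF.
have [yr|yr] := ltP `|y| r.
  apply: (le_trans (dA _ yr)); rewrite mulrDl ler_wpDr//.
    by apply: mulr_ge0 => //; apply: mulr_ge0; lra.
  rewrite -mulrA ler_wpM2l// /growth /Num.min; case: ltP => yy; first by nra.
  by nra.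
apply: (le_trans (dB _ yr)); rewrite mulrDl ler_wpDl//.
  by apply: mulr_ge0 => //; apply: mulr_ge0; lra.
rewrite [leRHS](_ : _ = B * (2 * (1 + r^-1 ^+ 2) * growth y)); last by ring.
rewrite ler_wpM2l// /growth /Num.min; case: ltP => yy.
  have y1 : `|y| < 1 by nra.
  have : 1 <= r^-1 ^+ 2 * `|y| ^+ 2 by rewrite -rr ler_wpM2l// ler_sqr ?nnegrE// ltW.
  by nra.
have [y0|] := eqVneq `|y| 0; first by move: yr; rewrite y0; lra.
move=> y0; have {N0 y0} : 0 < `|y| by rewrite lt_def y0.
by nra.
Qed.

(** Contact from above at [x] with a paraboloid of opening [K]. *)
Definition quad_above w x p (K r : R) :=
  forall y, `|y| < r -> w (x + y) <= w x + dot p y + K * sqn y.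

(** The constant depends on the data only through [B] and [r], hence serves for
    whole sequences of functions and contact points. *)
Lemma le_delta_growth (B r : R) : 0 <= B -> 0 < r ->
  exists2 C, 0 <= C & forall w x p,
    `|x| <= B -> - w x <= B -> (forall z, w z <= B * (1 + `|z|)) ->
    quad_above w x p B r ->
    forall y, delta w x y <= C * growth y.
Proof.
move=> B0 r0.
have [C C0 hC] := @le_growth (2 * B * n%:R) (2 * B * (2 + B)) r
  (mulr_ge0 (mulr_ge0 (ler0n _ 2) B0) (ler0n _ n))
  (mulr_ge0 (mulr_ge0 (ler0n _ 2) B0) (addr_ge0 (ler0n _ 2) B0)) r0.
exists C => // w x p xB wxB wB wq; apply: hC => y yr.
  have := wq y yr; have := wq (- y); rewrite normrN => /(_ yr).
  rewrite dotNr sqnN /delta.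
  have := ler_wpM2l B0 (sqn_le y); rewrite mulrA; lra.
have wy := wB (x + y); have wy' := wB (x - y).
have y1 := ler_wpM2l B0 (ler_normD x y).
have y2 := ler_wpM2l B0 (ler_normB x y).
have y3 := ler_wpM2l B0 xB.
have y4 : 0 <= B * B * `|y| by rewrite !mulr_ge0.
have y5 : 0 <= B * `|y| by rewrite !mulr_ge0.
have : (2 * B * (2 + B)) * (1 + `|y|) = 4 * B + 4 * (B * `|y|) + 2 * (B * B) + 2 * (B * B * `|y|).
  by ring.
rewrite /delta; lra.
Qed.

End pointwise_criterion.

(** * Viscosity solutions tested pointwise *)

Section paraboloid_patches.
Context {R : realType} {n : nat}.
Implicit Types (x y z p : 'rV[R]_n) (w f : 'rV[R]_n -> R).

Definition linear_growth w (B : R) := forall z, w z <= B * (1 + `|z|).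

Lemma quad_above_le w x p K K' r : K <= K' ->
  quad_above w x p K r -> quad_above w x p K' r.
Proof.
move=> KK wq y yr; apply: (le_trans (wq y yr)).
by rewrite lerD2l ler_wpM2r// sqn_ge0.
Qed.

Definition paraboloid_patch w x p K (r : R) :=
  patch w (ball x r) (paraboloid (w x) x p K).

Lemma paraboloid_patch_center w x p K r : 0 < r -> paraboloid_patch w x p K r x = w x.
Proof.
move=> r0; rewrite /paraboloid_patch /patch mem_set; last exact: ballxx.
by rewrite /paraboloid subrr dot0r sqn0; ring.
Qed.

Lemma paraboloid_patchD w x p K r y : paraboloid_patch w x p K r (x + y) =
  if `|y| < r then w x + dot p y + K * sqn y else w (x + y).
Proof.
rewrite /paraboloid_patch /patch; have <- : (x + y \in (ball x r : set 'rV[R]_n)) = (`|y| < r).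
  have -> : (`|y| < r) = (`|x - (x + y)| < r) by rewrite opprD addNKr normrN.
  by apply/idP/idP; rewrite inE -ball_normE.
by case: ifP => // _; rewrite /paraboloid [x + y]addrC addrK.
Qed.

Lemma measurable_paraboloid_patch w x p K r : measurable_fun setT w ->
  measurable_fun setT (paraboloid_patch w x p K r).
Proof.
move=> mw; apply: (@measurable_fun_ifT _ _ _ _ (paraboloid (w x) x p K) w
  (fun z => z \in (ball x r : set 'rV[R]_n))) => //.
  apply: (measurable_fun_bool true); rewrite setTI.
  rewrite (_ : _ @^-1` _ = ball x r); first exact: measurable_ball_rV.
  by apply/seteqP; split => z /= => [/set_mem|/mem_set].
by apply: continuous_measurable_rV; exact: continuous_paraboloid.
Qed.

Lemma delta_paraboloid_patch_near w x p K r y : 0 < r ->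
  \forall k \near \oo,
    delta (paraboloid_patch w x p K (r / k.+1%:R)) x y = delta w x y.
Proof.
move=> r0; have rk k : 0 < r / k.+1%:R by rewrite divr_gt0.
have [->|y0] := eqVneq y 0.
  by apply: nearW => k; rewrite /delta subr0 addr0; ring.
near=> k.
have yk : (`|y| < r / k.+1%:R) = false.
  apply/negbTE; rewrite -leNgt -ler_pdivlMl// mulrC ltW//.
  near: k.
  have e0 : 0 < `|y| / r by rewrite divr_gt0// normr_gt0.
  exact: near_infty_natSinv_lt (PosNum e0).
by rewrite /delta !paraboloid_patchD normrN yk paraboloid_patch_center.
Unshelve. all: by end_near. Qed.

Lemma le_delta_paraboloid_patch w B x p K r : 0 < r -> linear_growth w B ->
  quad_above w x p K r ->
  exists2 C, 0 <= C & forall k y,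
    delta (paraboloid_patch w x p K (r / k.+1%:R)) x y <= C * growth y.
Proof.
move=> r0 wB wq.
pose B' := `|B| + `|x| + `|w x| + n%:R * (`|p| * r) + `|K| * (n%:R * r ^+ 2)
  + `|K|.
have N1 := normr_ge0 B; have N2 := normr_ge0 x; have N3 := normr_ge0 (w x).
have N6 := normr_ge0 K; have K1 := ler_norm K.
have N4 : 0 <= n%:R * (`|p| * r) by rewrite mulr_ge0// mulr_ge0// ltW.
have N5 : 0 <= `|K| * (n%:R * r ^+ 2) by rewrite mulr_ge0// mulr_ge0// sqr_ge0.
have [||C C0 hC] := @le_delta_growth R n B' r => //.
  by rewrite /B'; lra.
exists C => // k y; apply: (hC _ _ p).
- by rewrite /B'; lra.
- rewrite paraboloid_patch_center ?divr_gt0//.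
  by have := ler_norm (- w x); rewrite normrN /B'; lra.
- move=> z; rewrite -(subrKC x z) paraboloid_patchD.
  set y' := z - x; case: ifPn => [yk|_]; last first.
    apply: (le_trans (wB _)); rewrite ler_wpM2r ?addr_ge0//.
    by have := ler_norm B; rewrite /B'; lra.
  have yr : `|y'| < r.
    by rewrite (lt_le_trans yk)// ler_pdivrMr// ler_peMr ?ler1n// ltW.
  rewrite (@le_trans _ _ B')//; last first.
    by rewrite ler_peMr ?lerDl//; rewrite /B'; lra.
  have h1 : dot p y' <= n%:R * (`|p| * r).
    rewrite (le_trans (ler_norm _))// (le_trans (dot_le _ _))//.
    by rewrite !ler_wpM2l// ltW.
  have h2 : K * sqn y' <= `|K| * (n%:R * r ^+ 2).
    apply: (@le_trans _ _ (`|K| * sqn y')); first by rewrite ler_wpM2r ?sqn_ge0.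
    rewrite ler_wpM2l// (le_trans (sqn_le _))// ler_wpM2l// ler_sqr ?nnegrE ?(ltW r0)//.
    exact: ltW.
  by have := ler_norm (w x); rewrite /B'; lra.
- move=> y' yr; rewrite paraboloid_patchD paraboloid_patch_center ?divr_gt0//.
  have KB : K * sqn y' <= B' * sqn y'.
    by rewrite ler_wpM2r ?sqn_ge0// /B'; lra.
  case: ifP => _; first by lra.
  by have := wq _ yr; lra.
Qed.

End paraboloid_patches.

Section viscosity_pointwise.
Context {R : realType} {n : nat}.
Variables (sigma : R) (F : R -> R) (L : R).
Hypothesis sigma_12 : 1 < sigma < 2.
Hypotheses (F_incr : {homo F : s t / s <= t}) (F_0 : F 0 = 0).
Hypothesis F_lip : forall s t, `|F s - F t| <= L * `|s - t|.
Implicit Types (x y z p : 'rV[R]_n) (w f eta : 'rV[R]_n -> R).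
Local Notation J := (second_order_integral sigma).

(** The inequality bears on [w] itself: no test function is patched in. *)
Definition pointwise_subsol w f := forall x p K r, 0 < r ->
  quad_above w x p K r -> ((f x)%:E <= J F (delta w x))%E.

Definition pointwise_supersol w f := forall x p K r, 0 < r ->
  quad_above (\- w)%R x p K r -> (J F (delta w x) <= (f x)%:E)%E.

Lemma deltaN w x y : delta (\- w) x y = - delta w x y.
Proof. by rewrite /delta /=; ring. Qed.

Lemma paraboloid_patchN w x p K r :
  paraboloid_patch (\- w) x p K r = \- paraboloid_patch w x (- p) (- K) r.
Proof.
apply/funext => z; rewrite /= /paraboloid_patch /patch; case: ifP => // _.
by rewrite /paraboloid /= dotNl; ring.
Qed.

(** Where [w] is touched from above by a paraboloid, testing with that
    paraboloid on smaller and smaller balls leaves [w] itself in the integral: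
    the part of the integrand inside the ball is controlled by the opening of the
    paraboloid. *)
Lemma visc_subsol_pointwise w f B : visc_subsol F sigma setT w f ->
  linear_growth w B -> pointwise_subsol w f.
Proof.
move=> [/usc_realP uw _ sub] wB x p K r r0 wq.
have mw := usc_measurable uw.
have [C C0 dC] := le_delta_paraboloid_patch r0 wB wq.
apply: (second_order_integral_limsup sigma_12 F_incr F_0 F_lip
  (d_ := fun k => delta (paraboloid_patch w x p K (r / k.+1%:R)) x)
  (c := fun=> f x) C0 _ _ dC).
- by move=> k; apply: measurable_delta; exact: measurable_paraboloid_patch.
- exact: measurable_delta.
- move=> y e e0; near=> k.
  rewrite (_ : delta _ _ _ = delta w x y) ?lerDl ?ltW//.
  near: k; exact: delta_paraboloid_patch_near.
- exact: cvg_cst.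
move=> k; have rk : 0 < r / k.+1%:R by rewrite divr_gt0.
apply: sub => //.
- exact: ball_open.
- exact: ballxx.
- exact: C11_paraboloid.
- by rewrite /paraboloid subrr dot0r sqn0; ring.
- move=> y; rewrite -ball_normE/= -normrN opprB => yx.
  have yr : `|y - x| < r.
    by rewrite (lt_le_trans yx)// ler_pdivrMr// ler_peMr ?ler1n// ltW.
  by have := wq _ yr; rewrite subrKC.
Unshelve. all: by end_near. Qed.

Lemma visc_supersol_pointwise w f B : visc_supersol F sigma setT w f ->
  linear_growth (\- w) B -> pointwise_supersol w f.
Proof.
move=> [/lscP uw _ super] wB x p K r r0 wq.
have mw : measurable_fun setT w.
  have -> : w = (\- (\- w))%R by apply/funext => z /=; rewrite opprK.
  by apply: measurable_funN; exact: usc_measurable.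
have [C C0 dC] := le_delta_paraboloid_patch r0 wB wq.
apply: (second_order_integral_liminf sigma_12 F_incr F_0 F_lip
  (d_ := fun k => delta (paraboloid_patch w x (- p) (- K) (r / k.+1%:R)) x)
  (c := fun=> f x) C0).
- by move=> k; apply: measurable_delta; exact: measurable_paraboloid_patch.
- exact: measurable_delta.
- by move=> k y; have := dC k y; rewrite paraboloid_patchN deltaN.
- move=> y e e0; near=> k.
  rewrite (_ : delta _ _ _ = delta w x y) ?lerDl ?ltW//.
  near: k; exact: delta_paraboloid_patch_near.
- exact: cvg_cst.
move=> k; have rk : 0 < r / k.+1%:R by rewrite divr_gt0.
apply: super => //.
- exact: ball_open.
- exact: ballxx.
- exact: C11_paraboloid.
- by rewrite /paraboloid subrr dot0r sqn0; ring.
- move=> y; rewrite -ball_normE/= -normrN opprB => yx.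
  rewrite /paraboloid.
  have yr : `|y - x| < r.
    by rewrite (lt_le_trans yx)// ler_pdivrMr// ler_peMr ?ler1n// ltW.
  by have /= := wq _ yr; rewrite dotNl mulNr subrKC; lra.
Unshelve. all: by end_near. Qed.

Lemma C11_quad_above U eta x : open U -> U x -> C11 U eta ->
  exists p K r, [/\ 0 < r, ball x r `<=` U, quad_above eta x p K r &
    quad_above (\- eta)%R x (- p) K r].
Proof.
move=> oU Ux ceta; have /nbhs_ballP[r /= r0 rU] : nbhs x U by exact: open_nbhs_nbhs.
have [K K0 etaK] := C11_taylor ceta.
exists (grad eta x), K, r.
have key y : `|y| < r -> `|eta (x + y) - eta x - dot (grad eta x) y| <= K * sqn y.
  move=> yr; rewrite (le_trans (etaK _ _ _)) ?ler_wpM2l ?sqr_norm_le_sqn//.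
  move=> t /andP[t0 t1]; apply: rU; rewrite -ball_normE/= opprD addNKr normrN normrZ.
  by rewrite ger0_norm// (le_lt_trans _ yr)// ler_piMl.
split => // y /key; rewrite ler_norml => /andP[].
  by lra.
by rewrite /= dotNl; lra.
Qed.

(** A patch lies above [w] and agrees with it at the contact point, so it can only
    increase the second difference. *)
Lemma pointwise_visc_subsol w f : usc w -> weighted_L1 sigma w ->
  pointwise_subsol w f -> visc_subsol F sigma setT w f.
Proof.
move=> uw iw sub; split => // x _ U eta oU Ux ceta etax weta.
have [p [K [r [r0 rU etaq _]]]] := C11_quad_above oU Ux ceta.
apply: (@le_trans _ _ (J F (delta w x))).
  apply: (sub x p K r) => // y yr; rewrite -etax (le_trans _ (etaq y yr))//.
  by apply: weta; apply: rU; rewrite -ball_normE/= opprD addNKr normrN.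
apply: le_second_order_integral => // y; rewrite /delta.
have wp z : w z <= patch w U eta z.
  by rewrite /patch; case: ifPn => //; rewrite inE; exact: weta.
rewrite [patch w U eta x]/patch mem_set// etax.
by have := wp (x + y); have := wp (x - y); lra.
Qed.

Lemma pointwise_visc_supersol w f : lsc w -> weighted_L1 sigma w ->
  pointwise_supersol w f -> visc_supersol F sigma setT w f.
Proof.
move=> uw iw super; split => // x _ U eta oU Ux ceta etax weta.
have [p [K [r [r0 rU _ etaq]]]] := C11_quad_above oU Ux ceta.
apply: (@le_trans _ _ (J F (delta w x))); last first.
  apply: (super x (- p) K r) => // y yr /=; rewrite -etax (le_trans _ (etaq y yr))//=.
  by rewrite lerN2; apply: weta; apply: rU; rewrite -ball_normE/= opprD addNKr normrN.
apply: le_second_order_integral => // y; rewrite /delta.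
have wp z : patch w U eta z <= w z.
  by rewrite /patch; case: ifPn => //; rewrite inE; exact: weta.
rewrite [patch w U eta x]/patch mem_set// etax.
by have := wp (x + y); have := wp (x - y); lra.
Qed.

End viscosity_pointwise.

(** * Comparison *)

Lemma lipschitz_continuous_rV (R : realType) n (phi : 'rV[R]_n -> R) (M : R) :
  (forall x y, `|phi x - phi y| <= M * `|x - y|) -> continuous phi.
Proof.
move=> lip x; apply/(@cvgrPdist_le _ _ _ (nbhs x)) => e e0.
have M0 : 0 < `|M| + 1 by rewrite ltr_wpDl.
near=> y; apply: (le_trans (lip x y)).
rewrite (@le_trans _ _ ((`|M| + 1) * `|x - y|))//.
  by rewrite ler_wpM2r// ler_wpDr// ler_norm.
rewrite -ler_pdivlMl//.
near: y; apply: cvgr_dist_le; first exact: cvg_id.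
by rewrite mulr_gt0// invr_gt0.
Unshelve. all: by end_near. Qed.

Section usc_compact.
Context {R : realType} {T : topologicalType}.

(** A cluster point, in the compact set, of the filter generated by the
    superlevel sets of the values of [f] is a maximum point. *)
Lemma usc_compact_max (A : set T) (f : T -> R) : compact A -> A !=set0 ->
  usc_real f ->
  exists2 c, A c & forall x, A x -> f x <= f c.
Proof.
move=> cA [x0 Ax0] uf.
pose up x := [set y | A y /\ f x <= f y].
pose G : set_system T := [set P | exists2 x, A x & up x `<=` P].
have FG : ProperFilter G.
  split; first by move=> [x Ax]; apply; split; [exact: Ax|exact: lexx].
  split.
  - by exists x0.
  - move=> P Q [x Ax xP] [y Ay yQ]; have [xy|yx] := leP (f x) (f y).
      by exists y => // z [Az yz]; split; [apply: xP; split=> //; exact: le_trans yz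
        |apply: yQ; split].
    exists x => // z [Az xz]; split; first by apply: xP; split.
    by apply: yQ; split=> //; exact: le_trans (ltW yx) xz.
  - by move=> P Q PQ [x Ax xP]; exists x => // y /xP /PQ.
have GA : G A by exists x0 => // y [].
have [c [Ac cG]] := cA G FG GA.
exists c => // x Ax; rewrite leNgt; apply/negP => cx.
have Gx : G (up x) by exists x.
by have [y [[_ xy]]] := cG _ _ Gx (uf _ _ cx); rewrite /= ltNge xy.
Qed.

End usc_compact.

Section comparison.
Context {R : realType} {n : nat}.
Implicit Types (x y z p : 'rV[R]_n).
Variables (sigma mu M N : R) (F : R -> R) (g : 'rV[R]_n -> R -> R)
  (phi : 'rV[R]_n -> R).
Hypothesis F_incr : {homo F : s t / s <= t}.
Hypotheses (mu_gt0 : 0 < mu) (M_ge0 : 0 <= M) (N_ge0 : 0 <= N).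
Hypothesis phi_lip : forall x y, `|phi x - phi y| <= M * `|x - y|.
Hypothesis g_lip : forall x y t, `|g x t - g y t| <= N * `|x - y|.
Hypothesis g_mono : forall x s t, s < t -> mu * (t - s) <= g x t - g x s.
Local Notation J := (second_order_integral sigma).

Lemma compact_norm_ball (r : R) : compact [set x : 'rV[R]_n | `|x| <= r].
Proof.
apply: bounded_closed_compact.
  by exists r; split=> // [|t rt x /= xr]; [exact: num_real|rewrite (le_trans xr)// ltW].
rewrite (_ : mkset _ = (fun x : 'rV[R]_n => `|x|) @^-1` [set t | t <= r])//.
by apply: closed_comp => [x _|]; [exact: norm_continuous|exact: closed_le].
Qed.

Lemma usc_bounded_above (a : 'rV[R]_n -> R) (r c : R) : usc_real a ->
  (forall x, r < `|x| -> a x <= c) -> exists2 A, 0 <= A & forall x, a x <= A.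
Proof.
move=> ua ac.
have K0 : [set x : 'rV[R]_n | `|x| <= `|r|] !=set0 by exists 0; rewrite /= normr0.
have [x0 x0r hx0] := usc_compact_max (@compact_norm_ball `|r|) K0 ua.
exists (`|a x0| + `|c|) => [|x]; first by rewrite addr_ge0.
have := normr_ge0 c; have := normr_ge0 (a x0).
have := ler_norm c; have := ler_norm (a x0).
have [xr|xr] := leP `|x| `|r|; first by have := hx0 _ xr; lra.
by have := ac x (le_lt_trans (ler_norm r) xr); lra.
Qed.

(** Doubling of variables.  At a maximum point of u x - v y - k |x - y|^2 both
    functions are touched by paraboloids and the second difference of [u] lies
    below that of [v], so the two equations can be compared at nearby points;
    the monotonicity of [g] then contradicts u > v once [k] is large.  *)
Lemma comparison u v : usc_real u -> usc_real (\- v) ->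
  pointwise_subsol sigma F u (fun x => g x (u x - phi x)) ->
  pointwise_supersol sigma F v (fun x => g x (v x - phi x)) ->
  (forall e, 0 < e -> exists r, forall x, r < `|x| -> u x - phi x <= e) ->
  (forall e, 0 < e -> exists r, forall x, r < `|x| -> - e <= v x - phi x) ->
  forall x, u x <= v x.
Proof.
move=> uu uv subu supv u_oo v_oo x0; rewrite leNgt; apply/negP => vu.
pose m := u x0 - v x0; have m0 : 0 < m by rewrite subr_gt0.
have phic : continuous phi by exact: lipschitz_continuous_rV phi_lip.
have ua : usc_real (fun x => u x - phi x).
  apply: usc_realD => //; apply: continuous_usc => x.
  exact: (@cvgN _ _ _ (nbhs x) _ phi _ (phic x)).
have ub : usc_real (fun x => phi x - v x).
  by apply: usc_realD => //; exact: continuous_usc.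
have m4 : 0 < m / 4 by lra.
have [r1 hr1] := u_oo _ m4; have [r2 hr2] := v_oo _ m4.
have [A1 A10 hA1] := usc_bounded_above ua hr1.
have [A2 A20 hA2] : exists2 A, 0 <= A & forall x, phi x - v x <= A.
  by apply: (usc_bounded_above ub (r := r2) (c := m / 4)) => x /hr2; lra.
pose A := A1 + A2.
pose S0 := A + M + 1; pose B := A + M * S0.
(* points closer than [t0] change [g] by less than its monotonicity gains *)
pose t0 := mu * m / (2 * (N + 1)).
have N0 : 0 <= N := N_ge0; have M0 : 0 <= M := M_ge0.
have N1 : 0 < 2 * (N + 1) by lra.
have t00 : 0 < t0 by rewrite /t0 divr_gt0// mulr_gt0.
have A0 : 0 <= A by rewrite /A; lra.
have MM0 : 0 <= M * M by exact: mulr_ge0.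
have MA0 : 0 <= M * A by exact: mulr_ge0.
have S00 : 0 <= S0 by rewrite /S0; lra.
have B0 : 0 <= B by rewrite /B addr_ge0// mulr_ge0.
(* the second term lets the penalty absorb the oscillation of [phi], the third
   one forces the two points within [t0] of each other *)
pose k := 1 + M ^+ 2 / m + B / t0 ^+ 2.
have k1 : 1 <= k.
  have h1 : 0 <= M ^+ 2 / m by rewrite divr_ge0 ?sqr_ge0// ltW.
  have h2 : 0 <= B / t0 ^+ 2 by rewrite divr_ge0 ?sqr_ge0.
  by rewrite /k; lra.
have km : M ^+ 2 <= k * m.
  rewrite -ler_pdivrMr// /k.
  have h2 : 0 <= B / t0 ^+ 2 by rewrite divr_ge0 ?sqr_ge0.
  lra.
have kt : B < k * t0 ^+ 2.
  rewrite -ltr_pdivrMr ?exprn_gt0// /k.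
  have h1 : 0 <= M ^+ 2 / m by rewrite divr_ge0 ?sqr_ge0// ltW.
  lra.
pose Phi (q : 'rV[R]_n * 'rV[R]_n) := u q.1 - v q.2 - k * sqn (q.1 - q.2).
have gap x y : m <= Phi (x, y) ->
    [/\ 3 * m / 4 <= (u x - phi x) - (v y - phi y) & `|x - y| < t0].
  rewrite /Phi/= => mP.
  have := phi_lip x y; rewrite ler_norml => /andP[_ pxy].
  have sq := sqr_norm_le_sqn (x - y).
  have s0 := normr_ge0 (x - y).
  set s := `|x - y| in pxy sq s0 *.
  have ks : k * s ^+ 2 <= k * sqn (x - y) by rewrite ler_wpM2l//; lra.
  have := hA1 x; have := hA2 y => hA2y hA1x.
  have k0 : 0 < k by lra.
  have Ms : M * s - k * s ^+ 2 <= m / 4.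
    rewrite -(ler_pM2l k0); have := sqr_ge0 (k * s - M / 2).
    nra.
  split; first lra.
  have ks2 : k * s ^+ 2 <= A + M * s by rewrite /A; lra.
  have sS : s <= S0.
    rewrite leNgt; apply/negP => Ss.
    have : 1 <= s by rewrite (le_trans _ (ltW Ss))// /S0; lra.
    rewrite /S0 in Ss; nra.
  have ksB : k * s ^+ 2 <= B.
    by apply: (le_trans ks2); rewrite lerD2l ler_wpM2l.
  rewrite ltNge; apply/negP => ts.
  have : t0 ^+ 2 <= s ^+ 2 by rewrite ler_sqr ?nnegrE ?(ltW t00).
  nra.
have Phix0 : Phi (x0, x0) = m by rewrite /Phi/= subrr sqn0 mulr0 subr0.
have uPhi : usc_real Phi.
  apply: usc_realD; first apply: usc_realD.
  - apply: (usc_real_comp (h := fst) _ uu) => q; exact: cvg_fst.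
  - apply: (usc_real_comp (h := snd) _ uv) => q; exact: cvg_snd.
  apply: continuous_usc => q.
  apply: (@cvgN _ _ _ (nbhs q)); apply: (@cvgM _ _ (nbhs q)); first exact: cvg_cst.
  apply: continuous_cvg; first exact: continuous_sqn.
  by apply: cvgB; [exact: cvg_fst|exact: cvg_snd].
pose r := `|r1| + `|r2| + t0.
have inK q : m <= Phi q -> `|q.1| <= r /\ `|q.2| <= r.
  case: q => x y /gap[h1 h2] /=.
  have xy : `|x| <= `|y| + `|x - y|.
    by rewrite -{1}(subrKC y x) (le_trans (ler_normD _ _)).
  have yx : `|y| <= `|x| + `|x - y|.
    by rewrite -{1}(subKr x y) (le_trans (ler_normB _ _)).
  have r10 := normr_ge0 r1; have r20 := normr_ge0 r2.
  have r1' := ler_norm r1; have r2' := ler_norm r2.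
  have [xr|xr] := leP `|x| r1; first by rewrite /r; split; lra.
  have [yr|yr] := leP `|y| r2; first by rewrite /r; split; lra.
  have := hr1 _ xr; have := hr2 _ yr; lra.
pose K := [set x : 'rV[R]_n | `|x| <= r] `*` [set x : 'rV[R]_n | `|x| <= r].
have cK : compact K by apply: compact_setX; exact: compact_norm_ball.
have Kx0 : K (x0, x0) by apply: inK; rewrite Phix0.
have [[x y] Kxy Phimax] :=
  usc_compact_max cK (ex_intro _ _ Kx0) uPhi.
have mxy : m <= Phi (x, y) by rewrite -Phix0 Phimax.
have {}Phimax q : Phi q <= Phi (x, y).
  have [/inK/Phimax//|qm] := leP m (Phi q).
  exact: (le_trans (ltW qm)).
have [h1 h2] := gap _ _ mxy.
have ineq z z' : u (x + z) - v (y + z') - k * sqn (x - y + (z - z'))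
    <= u x - v y - k * sqn (x - y).
  have := Phimax (x + z, y + z'); rewrite /Phi/=.
  by rewrite (_ : x + z - (y + z') = x - y + (z - z'))// opprD addrACA.
have tu : ((g x (u x - phi x))%:E <= J F (delta u x))%E.
  apply: (subu x ((2 * k) *: (x - y)) k 1) => // z _.
  have := ineq z 0; rewrite addr0 subr0 sqnD dotZl; lra.
have tv : (J F (delta v y) <= (g y (v y - phi y))%:E)%E.
  apply: (supv y ((- (2 * k)) *: (x - y)) k 1) => // z _ /=.
  have := ineq 0 z; rewrite addr0 sub0r sqnB dotZl; lra.
have dd : (J F (delta u x) <= J F (delta v y))%E.
  apply: le_second_order_integral => // z; rewrite /delta.
  have := ineq z z; have := ineq (- z) (- z); rewrite !subrr !addr0; lra.
have := le_trans tu (le_trans dd tv); rewrite lee_fin.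
have lt_ab : v y - phi y < u x - phi x by lra.
have := g_mono x lt_ab.
have := g_lip x y (v y - phi y); rewrite ler_norml => /andP[gl _].
have mm : mu * (3 * m / 4) <= mu * (u x - phi x - (v y - phi y)).
  by rewrite ler_wpM2l// ltW.
have Nt : N * `|x - y| <= (N + 1) * t0.
  by rewrite ler_pM// ?lerDl// ltW.
have Nt0 : (N + 1) * t0 = mu * m / 2 by rewrite /t0; field; lra.
have mm0 : 0 < mu * m by rewrite mulr_gt0.
lra.
Qed.

End comparison.

(** * Small integrals and flat bumps *)

Section small_integrals.
Context {R : realType} {n : nat}.
Variable sigma : R.
Hypothesis sigma_12 : 1 < sigma < 2.
Implicit Types (x y z p : 'rV[R]_n) (d : 'rV[R]_n -> R).
Local Notation leb := (lebesgue_rV (R := R) n).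
Local Notation I := (second_order_integral sigma idfun).

Lemma measurable_div_kernel d : measurable_fun setT d ->
  measurable_fun setT (fun y => d y / kernel sigma y).
Proof. by move=> md; apply: measurable_funM => //; exact: measurable_kernelV. Qed.

Lemma integrable_div_kernel d C : measurable_fun setT d ->
  (forall y, 0 <= d y <= C * growth y) ->
  leb.-integrable setT (fun y => (d y / kernel sigma y)%:E).
Proof.
move=> md dC.
apply: (@le_integrable _ _ _ leb _ measurableT _
  (fun y => C%:E * (growth y / kernel sigma y)%:E)%E).
- by apply/measurable_EFinP; exact: measurable_div_kernel.
- move=> y _; rewrite -EFinM !abse_EFin lee_fin mulrA [leLHS]normrM [leRHS]normrM.
  by have /andP[d0 dy] := dC y; rewrite ler_wpM2r// !ger0_norm// (le_trans d0).
- by apply: integrableZl => //; exact: integrable_growth_kernel.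
Qed.

(** Dominated convergence, with the profile [growth] as the majorant. *)
Lemma second_order_integral_vanish (d_ : nat -> 'rV[R]_n -> R) C :
  (forall k, measurable_fun setT (d_ k)) ->
  (forall k y, 0 <= d_ k y <= C * growth y) ->
  (forall y e, 0 < e -> \forall k \near \oo, d_ k y <= e) ->
  forall e, 0 < e -> \forall k \near \oo, (I (d_ k) <= e%:E)%E.
Proof.
move=> md dC d0 e e0.
have [|||||_ _ lim0] := @dominated_convergence _ _ R leb setT measurableT
  (fun k y => (d_ k y / kernel sigma y)%:E) (cst 0%E)
  (fun y => (C * growth y / kernel sigma y)%:E).
- by move=> k; apply/measurable_EFinP; exact: measurable_div_kernel.
- exact: measurable_cst.
- apply: aeW => y _; apply: cvg_EFin; first exact: nearW.
  rewrite -[X in _ --> X](mul0r (kernel sigma y)^-1).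
  apply: cvgM; last exact: cvg_cst.
  apply/cvgrPdist_le => t t0; near=> k.
  rewrite /= sub0r normrN ger0_norm; last by case/andP: (dC k y).
  by near: k; exact: d0.
- apply: (@eq_integrable _ _ _ _ _ measurableT
      (fun y => C%:E * (growth y / kernel sigma y)%:E)%E).
    by move=> y _; rewrite -EFinM mulrA.
  by apply: integrableZl => //; exact: integrable_growth_kernel.
- apply: aeW => y k _; rewrite abse_EFin lee_fin normrM.
  rewrite [ `|_^-1|]ger0_norm ?invr_ge0 ?kernel_ge0// ler_wpM2r ?invr_ge0 ?kernel_ge0//.
  by have /andP[? ?] := dC k y; rewrite ger0_norm.
rewrite integral0 in lim0.
have : \forall k \near \oo, (\int[leb]_y (d_ k y / kernel sigma y)%:E < e%:E)%E.
  have : \forall t \near (0%R : \bar R)%E, (t < e%:E)%E.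
    by apply: open_nbhs_nbhs; split; [exact: open_ereal_lt_ereal|rewrite /= lte_fin].
  exact: lim0.
apply: filterS => k; exact: ltW.
Unshelve. all: by end_near. Qed.

End small_integrals.

Section bump.
Context {R : realType} {n : nat}.
Implicit Types (x y z p : 'rV[R]_n).

Lemma sqr_dot_le x y : dot x y ^+ 2 <= sqn x * sqn y.
Proof.
have [y0|y0] := eqVneq (sqn y) 0.
  have : `|y| ^+ 2 <= 0 by rewrite -y0 sqr_norm_le_sqn.
  rewrite real_exprn_even_le0//= normr_eq0 => /eqP ->.
  by rewrite dot0r sqn0 mulr0 expr0n.
have {y0} y0 : 0 < sqn y by rewrite lt_def y0 sqn_ge0.
have := sqn_ge0 (sqn y *: x - dot x y *: y).
rewrite sqnB !sqnZ dotZl dotZr => h.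
rewrite -(ler_pM2l y0); nra.
Qed.

Definition bump (k : R) x : R := 2 / (1 + k * sqn x).

Let den_gt0 k x : 0 <= k -> 1 <= 1 + k * sqn x.
Proof. by move=> k0; rewrite lerDl mulr_ge0// sqn_ge0. Qed.

Lemma bump_ge0 k x : 0 <= k -> 0 <= bump k x.
Proof. by move=> k0; rewrite divr_ge0// (le_trans ler01) ?den_gt0. Qed.

Lemma bump_le2 k x : 0 <= k -> bump k x <= 2.
Proof.
move=> k0; rewrite ler_pdivrMr ?(lt_le_trans ltr01) ?den_gt0//.
by rewrite ler_peMr// den_gt0.
Qed.

Lemma bump_ge1 k x : 0 <= k -> k * sqn x <= 1 -> 1 <= bump k x.
Proof.
move=> k0 kx; rewrite ler_pdivlMr ?(lt_le_trans ltr01) ?den_gt0//.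
by rewrite mul1r; lra.
Qed.

Lemma continuous_bump k : 0 <= k -> continuous (bump k).
Proof.
move=> k0 x; apply: (@cvgM _ _ (nbhs x)); first exact: cvg_cst.
apply: (@cvgV _ _ (nbhs x)).
  by rewrite gt_eqF// (lt_le_trans ltr01)// den_gt0.
apply: (@cvgD _ _ _ (nbhs x)); first exact: cvg_cst.
apply: (@cvgM _ _ (nbhs x)); first exact: cvg_cst.
exact: continuous_sqn.
Qed.

(** The bump is semiconcave. With the denominators at x + y and x - y split into
    their even and odd parts in [y], the second difference is controlled by the
    square of the odd part, and Cauchy-Schwarz bounds that square by k |y|^2 times
    the denominator at [x]. *)
Lemma delta_bump k x y : 0 <= k ->
  delta (bump k) x y <= Num.min (16 * (k * sqn y)) 4.
Proof.
move=> k0; rewrite le_min; apply/andP; split; last first.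
  rewrite /delta; have := bump_le2 (x + y) k0; have := bump_le2 (x - y) k0.
  by have := bump_ge0 x k0; lra.
have cs := sqr_dot_le x y.
rewrite /delta /bump.
have a1 := den_gt0 (x + y) k0; have b1 := den_gt0 (x - y) k0; have c1 := den_gt0 x k0.
move: a1 b1 c1; rewrite sqnB sqnD.
have := sqn_ge0 x; have := sqn_ge0 y.
move: (sqn x) (sqn y) (dot x y) cs => q h t cs h0 q0.
set a := 1 + k * (q + 2 * t + h); set b := 1 + k * (q - 2 * t + h).
set c := 1 + k * q => a1 b1 c1.
have k2 : k ^+ 2 * t ^+ 2 <= k ^+ 2 * (q * h) by rewrite ler_wpM2l// sqr_ge0.
have kh : 0 <= k * h by exact: mulr_ge0.
have abc : 0 < a * b * c by rewrite !mulr_gt0//; lra.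
rewrite [leLHS](_ : _ = (2 * b * c + 2 * a * c - 4 * (a * b)) / (a * b * c)); last first.
  by field; rewrite !gt_eqF//; lra.
rewrite ler_pdivrMr//.
have num : 2 * b * c + 2 * a * c - 4 * (a * b) <= 16 * (k * h) * c.
  have khk : 0 <= (k * h) * (k * h) by exact: mulr_ge0.
  have kqk : 0 <= (k * q) * (k * h) by rewrite !mulr_ge0.
  rewrite /a /b /c; nra.
apply: (le_trans num); rewrite ler_wpM2l ?mulr_ge0//.
have ab1 : 1 <= a * b by rewrite -[leLHS]mulr1 ler_pM.
by rewrite ler_peMl//; lra.
Qed.

End bump.

(** * The obstacle at infinity *)

Section obstacle.
Context {R : realType} {n : nat}.
Variables (sigma M : R) (phi : 'rV[R]_n -> R).
Hypothesis sigma_12 : 1 < sigma < 2.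
Hypotheses (phi_convex : convex_function setT phi) (phi_C11 : C11 setT phi).
Hypotheses (M_ge0 : 0 <= M) (phi_lip : forall x y, `|phi x - phi y| <= M * `|x - y|).
Implicit Types (x y z p : 'rV[R]_n).
Local Notation I := (second_order_integral sigma idfun).

Lemma delta_convex_ge0 x y : 0 <= delta phi x y.
Proof.
have h0 : 0 <= 2^-1 :> R by rewrite invr_ge0.
have h1 : 2^-1 <= 1 :> R by rewrite invf_le1// ler1n.
have := phi_convex (Itv01 h0 h1) (in_setT (x + y)) (in_setT (x - y)).
rewrite convRE [X in phi X](_ : _ = x); last first.
  rewrite /conv/= /unstable.onem.
  have -> : 1 - 2^-1 = 2^-1 :> R by field.
  rewrite -scalerDr addrACA subrr addr0 (_ : x + x = 2 *: x).
    by rewrite scalerA mulVf ?scale1r.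
  by rewrite scaler_nat mulr2n.
by rewrite /delta/= /unstable.onem; lra.
Qed.

Lemma C11_delta U (f : 'rV[R]_n -> R) : C11 U f -> exists2 K, 0 <= K &
  forall x y, (forall t, `|t| <= 1 -> U (x + t *: y)) ->
    `|delta f x y| <= K * `|y| ^+ 2.
Proof.
move=> cf; have [K K0 taylor] := C11_taylor cf; exists (2 * K); first by rewrite mulr_ge0.
move=> x y Uxy.
have h1 : `|f (x + y) - f x - dot (grad f x) y| <= K * `|y| ^+ 2.
  by apply: taylor => t /andP[t0 t1]; apply: Uxy; rewrite ger0_norm.
have h2 : `|f (x - y) - f x - dot (grad f x) (- y)| <= K * `|y| ^+ 2.
  rewrite -(normrN y); apply: taylor => t /andP[t0 t1].
  by rewrite scalerN -scaleNr; apply: Uxy; rewrite normrN ger0_norm.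
move: h1 h2; rewrite dotNr !ler_norml /delta => /andP[? ?] /andP[? ?].
by apply/andP; split; lra.
Qed.

Lemma delta_obstacle_growth : exists2 C, 0 <= C &
  forall x y, delta phi x y <= C * growth y.
Proof.
have [K K0 hK] := C11_delta phi_C11.
have M0 : 0 <= M := M_ge0.
exists (K + 2 * M) => [|x y]; first by rewrite addr_ge0 ?mulr_ge0.
have d1 : delta phi x y <= K * `|y| ^+ 2.
  by rewrite (le_trans (ler_norm _))// hK.
have d2 : delta phi x y <= 2 * M * `|y|.
  have := phi_lip (x + y) x; have := phi_lip (x - y) x.
  rewrite addrAC subrr add0r normrN addrAC subrr add0r !ler_norml /delta.
  by move=> /andP[_ ?] /andP[_ ?]; lra.
have y0 := normr_ge0 y; have yy := sqr_ge0 `|y|.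
rewrite /growth /Num.min; case: ltP => _; rewrite mulrDl.
  by rewrite (le_trans d1)// lerDl !mulr_ge0.
by rewrite (le_trans d2)// lerDr !mulr_ge0.
Qed.

Lemma continuous_obstacle : continuous phi.
Proof. exact: lipschitz_continuous_rV phi_lip. Qed.

Lemma second_order_integral_obstacle_bounded : exists2 C, 0 <= C &
  forall x, (I (delta phi x) <= C%:E)%E.
Proof.
have [C C0 dC] := delta_obstacle_growth.
have iG : (lebesgue_rV n).-integrable setT
    (fun y => ((C * growth y) / kernel sigma y)%:E).
  apply: integrable_div_kernel => // [|y]; last by rewrite mulr_ge0 ?growth_ge0//=.
  by apply: measurable_funM => //; exact: measurable_growth.
have fG : I (fun y : 'rV[R]_n => C * growth y) \is a fin_num.
  exact: integrable_fin_num.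
exists (fine (I (fun y : 'rV[R]_n => C * growth y))) => [|x].
  rewrite fine_ge0//; apply: integral_ge0 => y _.
  by rewrite lee_fin divr_ge0 ?kernel_ge0// mulr_ge0 ?growth_ge0.
rewrite fineK//; apply: le_second_order_integral => //.
Qed.

Hypothesis phi_cone : close_to_cone phi.

(** A cone flattens at infinity: by homogeneity its second difference at [x] in
    a fixed direction is, after rescaling [x] to a sphere, of the order of the
    inverse of the norm of [x]; the perturbation is small there as well. *)
Lemma delta_obstacle_vanish y e : 0 < e ->
  exists r, forall x, r < `|x| -> delta phi x y <= e.
Proof.
move=> e0; have [Gamma [eta [Ghom [r0 [C [eps [/andP[eps0 _] /=]]]]]]] := phi_cone.
set D := [set x | r0 < enorm x] => -[phiE eta_C11 etaC _ _].
have [K K0 hK] := C11_delta phi_C11.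
have [K' K'0 hK'] := C11_delta eta_C11.
(* a vector of norm [rho] stays in [D] after a shift of norm at most 1 *)
pose rho := `|r0| + 2.
have rho2 : 2 <= rho by rewrite /rho lerDr.
have rho0 : 0 < rho by lra.
have Dbig z : `|r0| < `|z| -> D z.
  move=> rz; rewrite /D/= (lt_le_trans _ (norm_le_enorm z))//.
  by rewrite (le_lt_trans (ler_norm _)).
have dGamma w z : `|w| = rho -> `|z| <= 1 -> delta Gamma w z <= (K + K') * `|z| ^+ 2.
  move=> wrho z1.
  have Dw t : `|t| <= 1 -> D (w + t *: z).
    move=> t1; apply: Dbig; rewrite (@lt_le_trans _ _ (rho - 1))//.
      by rewrite /rho; lra.
    have := lerB_normD w (t *: z); rewrite wrho normrZ => h.
    by have : `|t| * `|z| <= 1 * 1 by [rewrite ler_pM]; lra.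
  have := hK w z (fun _ _ => Logic.I); have := hK' w z Dw.
  have := Dw 1; rewrite normr1 lexx scale1r => /(_ isT) D1.
  have := Dw (-1); rewrite normrN1 lexx scaleN1r => /(_ isT) D2.
  have := Dw 0; rewrite normr0 ler01 scale0r addr0 => /(_ isT) D3.
  rewrite /delta !phiE// !ler_norml => /andP[? ?] /andP[? ?]; lra.
have [r1 hr1] : exists r1, forall z, r1 < `|z| -> `|eta z| <= e / 8.
  pose T := (8 * (`|C| + 1) / e) `^ eps^-1.
  have C1 : 0 < `|C| + 1 by rewrite ltr_wpDl.
  have a0 : 0 < 8 * (`|C| + 1) / e by rewrite divr_gt0// mulr_gt0.
  have T0 : 0 < T by exact: powR_gt0.
  exists (`|r0| + T) => z rz; have r00 := normr_ge0 r0.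
  have Dz : D z by apply: Dbig; lra.
  apply: (le_trans (etaC _ Dz)).
  have zT : T <= enorm z by apply: (le_trans _ (norm_le_enorm z)); lra.
  have zp : 8 * (`|C| + 1) / e <= enorm z `^ eps.
    apply: (@le_trans _ _ (T `^ eps)); first by rewrite -powRrM mulVf ?gt_eqF// powRr1// ltW.
    by apply: ge0_ler_powR; rewrite ?nnegrE ?enorm_ge0 ?(ltW eps0) ?(ltW T0).
  apply: (@le_trans _ _ ((`|C| + 1) * enorm z `^ (- eps))).
    by rewrite ler_wpM2r ?powR_ge0// ler_wpDr// ler_norm.
  rewrite powRN ler_pdivrMr ?(lt_le_trans a0)//.
  by rewrite mulrC -ler_pdivrMr ?divr_gt0// invf_div mulrCA mulrA.
pose r := `|r1| + `|r0| + `|y| * (1 + rho) + 2 * (K + K') * rho * `|y| ^+ 2 / e + rho.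
exists r => x rx.
have r10 := normr_ge0 r1; have r00 := normr_ge0 r0; have y0 := normr_ge0 y.
have r1r := ler_norm r1.
have yrho : 0 <= `|y| * rho by rewrite mulr_ge0// ltW.
have KK0 : 0 <= 2 * (K + K') * rho * `|y| ^+ 2.
  by rewrite mulr_ge0 ?sqr_ge0// mulr_ge0 ?(ltW rho0)//; lra.
have KKe : 0 <= 2 * (K + K') * rho * `|y| ^+ 2 / e by rewrite divr_ge0// ltW.
have t0 : 0 < `|x| by rewrite (lt_trans _ rx)// /r; lra.
have xy1 : `|x| - `|y| <= `|x + y| by exact: lerB_normD.
have xy2 : `|x| - `|y| <= `|x - y| by exact: lerB_dist.
have far1 : `|r0| + `|r1| < `|x + y| by rewrite /r in rx; lra.
have far2 : `|r0| + `|r1| < `|x - y| by rewrite /r in rx; lra.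
have far3 : `|r0| + `|r1| < `|x| by rewrite /r in rx; lra.
have dphi : delta phi x y = delta Gamma x y + delta eta x y.
  have rr0 : `|r0| <= `|r0| + `|r1| by rewrite lerDl.
  rewrite /delta (phiE _ (Dbig _ (le_lt_trans rr0 far1))).
  rewrite (phiE _ (Dbig _ (le_lt_trans rr0 far2))).
  by rewrite (phiE _ (Dbig _ (le_lt_trans rr0 far3))); ring.
have deta : delta eta x y <= e / 2.
  have := hr1 (x + y); have := hr1 (x - y); have := hr1 x.
  rewrite /delta => h1 h2 h3.
  have rr : r1 <= `|r0| + `|r1| by rewrite (le_trans r1r)// lerDr.
  have := h1 (le_lt_trans rr far3); have := h2 (le_lt_trans rr far2).
  have := h3 (le_lt_trans rr far1).
  by rewrite !ler_norml => /andP[? ?] /andP[? ?] /andP[? ?]; lra.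
pose a := rho / `|x|.
have a0 : 0 < a by rewrite divr_gt0.
have dG : a * delta Gamma x y <= (K + K') * (a * `|y|) ^+ 2.
  have <- : delta Gamma (a *: x) (a *: y) = a * delta Gamma x y.
    by rewrite /delta -scalerDr -scalerBr !Ghom//; ring.
  have <- : `|a *: y| = a * `|y| by rewrite normrZ gtr0_norm.
  apply: dGamma; rewrite normrZ gtr0_norm// /a.
    by rewrite divfK// gt_eqF.
  by rewrite mulrAC ler_pdivrMr// mul1r /r in rx *; lra.
have {}dG : delta Gamma x y <= e / 2.
  have dG' : delta Gamma x y <= (K + K') * a * `|y| ^+ 2.
    by rewrite -(ler_pM2l a0) (le_trans dG)// exprMn; nra.
  rewrite (le_trans dG')// /a mulrA mulrAC ler_pdivrMr//.
  have : 2 * (K + K') * rho * `|y| ^+ 2 / e <= `|x| by rewrite /r in rx; lra.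
  by rewrite ler_pdivrMr//; lra.
by rewrite dphi; lra.
Qed.

(** Dominated convergence along a sequence of points that would contradict the
    decay. *)
Lemma second_order_integral_obstacle_vanish e : 0 < e ->
  exists r, forall x, r < `|x| -> (I (delta phi x) <= e%:E)%E.
Proof.
move=> e0; apply: contrapT => nr.
have /choice[x xP] : forall k : nat, exists x, k%:R < `|x| /\ ~ (I (delta phi x) <= e%:E)%E.
  move=> k; apply: contrapT => nx; apply: nr; exists k%:R => x kx.
  by apply: contrapT => nI; apply: nx; exists x.
have [C C0 dC] := delta_obstacle_growth.
have := @second_order_integral_vanish R n sigma sigma_12 (fun k => delta phi (x k)) C
  (fun k => measurable_delta (x k) (continuous_measurable_rV continuous_obstacle)).
case/(_ _ _ _ e0).
- by move=> k y; rewrite delta_convex_ge0 dC.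
- move=> y t t0; have [r hr] := delta_obstacle_vanish y t0.
  near=> k; apply: hr; rewrite (lt_trans _ (xP k).1)//.
  near: k; exact: nbhs_infty_gtr.
by move=> k _ /(_ k (leqnn k)); exact: (xP k).2.
Unshelve. all: by end_near. Qed.

End obstacle.

(** * Barriers *)

Section barrier.
Context {R : realType} {n : nat}.
Variables (sigma mu L M : R) (F : R -> R) (g : 'rV[R]_n -> R -> R)
  (phi : 'rV[R]_n -> R).
Hypothesis sigma_12 : 1 < sigma < 2.
Hypotheses (F_incr : {homo F : s t / s <= t}) (F_0 : F 0 = 0).
Hypothesis F_lip : forall s t, `|F s - F t| <= L * `|s - t|.
Hypothesis mu_gt0 : 0 < mu.
Hypothesis g_mono : forall x s t, s < t -> mu * (t - s) <= g x t - g x s.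
Hypothesis g_0 : forall x, g x 0 = 0.
Hypotheses (phi_convex : convex_function setT phi) (phi_C11 : C11 setT phi).
Hypotheses (M_ge0 : 0 <= M) (phi_lip : forall x y, `|phi x - phi y| <= M * `|x - y|).
Hypothesis phi_cone : close_to_cone phi.
Implicit Types (x y z p : 'rV[R]_n).
Local Notation J := (second_order_integral sigma).
Local Notation I := (second_order_integral sigma idfun).

Let L0 : 0 <= L.
Proof. by have := F_lip 1 0; rewrite subr0 normr1 mulr1; exact: le_trans. Qed.

Let F_le t : 0 <= t -> F t <= L * t.
Proof.
move=> t0; have := F_lip t 0; rewrite F_0 !subr0 (ger0_norm t0).
exact: le_trans (ler_norm _).
Qed.

Let g_ge x t : 0 <= t -> mu * t <= g x t.
Proof.
rewrite le_eqVlt => /predU1P[<-|t0]; first by rewrite mulr0 g_0.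
by have := g_mono x t0; rewrite g_0 !subr0.
Qed.

Let cap k y : R := Num.min (16 * (k * sqn y)) 4.

Let measurable_cap k : measurable_fun setT (cap k).
Proof.
apply: measurable_minr => //; apply: measurable_funM => //; apply: measurable_funM => //.
by apply: continuous_measurable_rV; exact: continuous_sqn.
Qed.

Let cap_growth k y : 0 <= k <= 1 -> 0 <= cap k y <= (16 * n%:R + 4) * growth y.
Proof.
move=> /andP[k0 k1]; have q0 := sqn_ge0 y; have q1 := sqn_le y; have y0 := normr_ge0 y.
have n0 : 0 <= n%:R :> R by [].
apply/andP; split; first by rewrite le_min; apply/andP; split=> //; rewrite !mulr_ge0.
rewrite /cap /growth; have [y1|y1] := ltP `|y| 1.
  rewrite (_ : Num.min (`|y| ^+ 2) _ = `|y| ^+ 2); last by apply/min_idPl; nra.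
  rewrite ge_min; apply/orP; left.
  have kq : k * sqn y <= sqn y by rewrite ler_piMl.
  by have := sqr_ge0 `|y|; lra.
rewrite (_ : Num.min (`|y| ^+ 2) _ = `|y|); last by apply/min_idPr; nra.
rewrite ge_min; apply/orP; right.
have : 0 <= n%:R * `|y| by rewrite mulr_ge0.
by lra.
Qed.

(** Adding to the obstacle a small constant and a high but very flat bump gives
    a supersolution: the bump dominates the integral of the obstacle on the ball
    outside which that integral is negligible, and its own second differences have
    small integral because it is flat. *)
Lemma barrier e : 0 < e -> exists psi : 'rV[R]_n -> R,
  [/\ continuous psi, (forall x, 0 <= psi x),
      exists r, forall x, r < `|x| -> psi x <= e &
      forall x, (J F (delta (fun x => (phi x + psi x)%R) x) <= (g x (psi x))%:E)%E].
Proof.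
move=> e0.
have L1 : 0 < L + 1 by have := L0; lra.
have [C0 C00 hC0] := second_order_integral_obstacle_bounded sigma_12 phi_C11 M_ge0 phi_lip.
pose e1 := mu * (e / 2) / (2 * (L + 1)).
have e10 : 0 < e1 by apply: divr_gt0; [apply: mulr_gt0 => //; lra|lra].
have [r hr] := second_order_integral_obstacle_vanish sigma_12 phi_convex phi_C11
  M_ge0 phi_lip phi_cone e10.
(* the height at which mu times the bump pays for the obstacle on the ball of
   radius [r] *)
pose A := (L + 1) * C0 / mu.
have A0 : 0 <= A by rewrite divr_ge0 ?mulr_ge0// ltW.
pose e2 := mu * (e / 2) / (2 * (L + 1) * (A + 1)).
have e20 : 0 < e2.
  by apply: divr_gt0; apply: mulr_gt0 => //; lra.
have k01 j : 0 < (j.+1%:R^-1 : R) <= 1 by rewrite invr_gt0 ltr0n/= invf_le1// ler1n.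
have [k [k0 kr kI]] : exists k : R, [/\ 0 < k <= 1, k * (n%:R * r ^+ 2) <= 1 &
    (I (cap k) <= e2%:E)%E].
  have nearI : \forall j \near \oo, (I (cap j.+1%:R^-1) <= e2%:E)%E.
    apply: (@second_order_integral_vanish _ _ _ sigma_12 _ (16 * n%:R + 4)) => //.
    - move=> j y; apply: cap_growth; have /andP[j0 ->] := k01 j.
      by rewrite ltW.
    - move=> y t t0.
      have q0 := sqn_ge0 y.
      have t' : 0 < t / (16 * (sqn y + 1)) by rewrite divr_gt0// mulr_gt0//; lra.
      near=> j.
      have : j.+1%:R^-1 < t / (16 * (sqn y + 1)).
        by near: j; exact: near_infty_natSinv_lt (PosNum t').
      have /andP[j0 _] := k01 j.
      rewrite ltr_pdivlMr ?mulr_gt0//; last lra.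
      rewrite ge_min; move: (j.+1%:R^-1 : R) j0 => k' k'0 kt.
      by apply/orP; left; lra.
  have c0 : 0 < (n%:R * r ^+ 2 + 1)^-1.
    by rewrite invr_gt0; have : 0 <= n%:R * r ^+ 2 by [rewrite mulr_ge0 ?sqr_ge0]; lra.
  have nearr : \forall j \near \oo, j.+1%:R^-1 < (n%:R * r ^+ 2 + 1)^-1 :> R.
    exact: near_infty_natSinv_lt (PosNum c0).
  have [j [jI jr]] : exists j : nat, (I (cap j.+1%:R^-1) <= e2%:E)%E /\
      j.+1%:R^-1 < (n%:R * r ^+ 2 + 1)^-1 :> R.
    apply: (@filter_ex _ (\oo : set_system nat)).
    by near=> j; split; near: j.
  exists (j.+1%:R^-1); split => //.
  have nr0 : 0 <= n%:R * r ^+ 2 by rewrite mulr_ge0 ?sqr_ge0.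
  rewrite mulrC -ler_pdivlMr ?invr_gt0//.
  rewrite invrK mul1r -[j.+1%:R]invrK (le_trans _ (_ : (n%:R * r ^+ 2 + 1) <= _))//.
    by rewrite lerDl.
  by rewrite -[leLHS]invrK lef_pV2 ?posrE ?invr_gt0 ?ltW//; lra.
have /andP[kpos k1] := k0.
have kge0 := ltW kpos.
have A00 := A0.
pose psi x := e / 2 + A * bump k x.
have bge0 x : 0 <= bump k x by exact: bump_ge0.
have psi0 x : 0 <= psi x by apply: addr_ge0; [lra|exact: mulr_ge0].
exists psi; split => //.
- move=> x; apply: (@cvgD _ _ _ (nbhs x)); first exact: cvg_cst.
  apply: (@cvgM _ _ (nbhs x)); first exact: cvg_cst.
  exact: continuous_bump.
- pose s := 1 + 4 * A / (e * k).
  have ek : 0 < e * k by exact: mulr_gt0.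
  have s0 : 0 <= 4 * A / (e * k) by rewrite divr_ge0 ?(ltW ek)// mulr_ge0.
  exists s => x sx; rewrite /psi /bump.
  have x1 : 1 < `|x| by rewrite (le_lt_trans _ sx)// /s lerDl.
  have xx : `|x| <= sqn x.
    by rewrite (le_trans _ (sqr_norm_le_sqn x))// expr2 ler_peMl// ltW.
  have d0 : 0 < 1 + k * sqn x by rewrite ltr_pwDl// mulr_ge0 ?sqn_ge0.
  have key : 4 * A <= e * (1 + k * sqn x).
    have : 4 * A / (e * k) <= sqn x by rewrite (le_trans _ xx)// (le_trans _ (ltW sx))// /s lerDr.
    by rewrite ler_pdivrMr//; lra.
  have : A * (2 / (1 + k * sqn x)) <= e / 2 by rewrite mulrA ler_pdivrMr//; lra.
  lra.
move=> x; apply: (@le_trans _ _ (mu * psi x)%:E); last by rewrite lee_fin g_ge.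
have dphi0 y : 0 <= delta phi x y by exact: delta_convex_ge0.
have cap0 y : 0 <= cap k y.
  by have /andP[] : 0 <= cap k y <= (16 * n%:R + 4) * growth y
    by [apply: cap_growth; rewrite kge0].
have dle y : delta (fun x => phi x + psi x) x y <= delta phi x y + A * cap k y.
  have := ler_wpM2l A0 (delta_bump x y kge0).
  rewrite -/(cap k y) /delta /psi; lra.
apply: (@le_trans _ _ ((L + 1)%:E * I (delta phi x) + ((L + 1) * A)%:E * I (cap k))%E).
  have [C C0' dC] := delta_obstacle_growth phi_C11 M_ge0 phi_lip.
  have mdelta := measurable_delta x (continuous_measurable_rV (continuous_obstacle phi_lip)).
  have mI (d : 'rV[R]_n -> R) : measurable_fun setT d ->
      measurable_fun setT (fun y : 'rV[R]_n => (idfun (d y) / kernel sigma y)%:E).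
    by move=> md; apply/measurable_EFinP; exact: measurable_div_kernel.
  have pos (c : R) (d : 'rV[R]_n -> R) y : 0 <= c -> 0 <= d y ->
      (0 <= c%:E * (idfun (d y) / kernel sigma y)%:E)%E.
    by move=> c0 dy0; rewrite -EFinM lee_fin mulr_ge0// divr_ge0 ?kernel_ge0.
  have Zl (c : R) (d : 'rV[R]_n -> R) : 0 <= c -> measurable_fun setT d -> (forall y, 0 <= d y) ->
      (c%:E * I d = \int[lebesgue_rV n]_y (c%:E * (idfun (d y) / kernel sigma y)%:E))%E.
    move=> c0 md d0; rewrite /second_order_integral ge0_integralZl//.
    - exact: mI.
    - by move=> y _; rewrite lee_fin; apply: divr_ge0; [exact: d0|exact: kernel_ge0].
  have L10 := ltW L1.
  rewrite (Zl _ _ L10 mdelta dphi0) (Zl _ _ (mulr_ge0 L10 A0) (measurable_cap k) cap0).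
  rewrite -ge0_integralD//; try by [apply: emeasurable_funM => //; exact: mI |
    move=> y _; apply: pos => //; exact: mulr_ge0].
  apply: le_integral_pointwise => y; rewrite -!EFinM -EFinD lee_fin.
  rewrite [(L + 1) * (idfun _ / _)]mulrA [(L + 1) * A * (idfun _ / _)]mulrA -mulrDl.
  rewrite ler_wpM2r ?invr_ge0 ?kernel_ge0//.
  apply: (le_trans (F_incr (dle y))).
  have sum0 : 0 <= delta phi x y + A * cap k y.
    apply: addr_ge0; first exact: dphi0.
    by apply: mulr_ge0; [exact: A0|exact: cap0].
  by apply: (le_trans (F_le sum0)) => /=; lra.
have L10 := ltW L1.
have I0 (d : 'rV[R]_n -> R) : (forall y, 0 <= d y) -> (0 <= I d)%E.
  move=> d0; apply: integral_ge0 => y _; rewrite lee_fin.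
  by apply: divr_ge0; [exact: d0|exact: kernel_ge0].
have small : (((L + 1) * A)%:E * I (cap k) <= (mu * e / 4)%:E)%E.
  apply: (@le_trans _ _ (((L + 1) * A) * e2)%:E).
    rewrite [leRHS]EFinM; apply: lee_pmul => //; last exact: I0.
    by rewrite lee_fin mulr_ge0.
  rewrite lee_fin /e2 mulrA ler_pdivrMr; last by apply: mulr_gt0; lra.
  have : 0 <= mu * e * (L + 1) by rewrite !mulr_ge0// ltW.
  by lra.
have [xr|xr] := ltP r `|x|.
  apply: (@le_trans _ _ ((L + 1) * e1 + mu * e / 4)%:E).
    rewrite [leRHS]EFinD; apply: leeD => //; rewrite [leRHS]EFinM.
    apply: lee_pmul => //; last exact: hr.
    exact: I0.
  rewrite lee_fin /psi.
  have -> : (L + 1) * e1 = mu * e / 4 by rewrite /e1; field; lra.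
  have : 0 <= mu * (A * bump k x) by apply: mulr_ge0; [exact: ltW|exact: mulr_ge0].
  by lra.
apply: (@le_trans _ _ ((L + 1) * C0 + mu * e / 4)%:E).
  rewrite [leRHS]EFinD; apply: leeD => //; rewrite [leRHS]EFinM; apply: lee_pmul => //.
  exact: I0.
rewrite lee_fin /psi.
have -> : (L + 1) * C0 = mu * A by rewrite /A; field; rewrite gt_eqF.
have x0 := normr_ge0 x.
have b1 : 1 <= bump k x.
  apply: bump_ge1 => //; apply: le_trans kr; rewrite ler_wpM2l//.
  by rewrite (le_trans (sqn_le x))// ler_wpM2l// ler_sqr ?nnegrE// (le_trans x0).
have muA : 0 <= mu * A by apply: mulr_ge0 => //; exact: ltW.
have : mu * A * 1 <= mu * A * bump k x by rewrite ler_wpM2l.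
have : 0 < mu * e by rewrite mulr_gt0.
by lra.
Unshelve. all: by end_near. Qed.

End barrier.

(** * Envelopes and stability *)

Section usc_envelope.
Context {R : realType} {T : topologicalType}.
Variables (u h : T -> R).
Hypotheses (uh : forall x, u x <= h x) (usc_h : usc_real h).

Definition usc_env (u : T -> R) (x : T) : R := inf [set a | \forall z \near x, u z <= a].

Let env_lb (x : T) : lbound [set a | \forall z \near x, u z <= a] (u x).
Proof. by move=> a /= /nbhs_singleton. Qed.

Let env_ex (x : T) : [set a | \forall z \near x, u z <= a] !=set0.
Proof.
exists (h x + 1) => /=; have : h x < h x + 1 by rewrite ltrDl.
by move=> /usc_h; apply: filterS => z hz; rewrite (le_trans (uh z))// ltW.
Qed.

Lemma usc_env_ge x : u x <= usc_env u x.
Proof. by apply: lb_le_inf => //; exact: env_lb. Qed.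

Lemma usc_env_le (x : T) a : (\forall z \near x, u z <= a) -> usc_env u x <= a.
Proof. by move=> ua; apply: ge_inf => //; exists (u x); exact: env_lb. Qed.

Lemma usc_env_le_usc x : usc_env u x <= h x.
Proof.
apply/ler_addgt0Pr => e e0; apply: usc_env_le.
have : h x < h x + e by rewrite ltrDl.
by move=> /usc_h; apply: filterS => z hz; rewrite (le_trans (uh z))// ltW.
Qed.

Lemma usc_env_usc : usc_real (usc_env u).
Proof.
move=> x a xa.
have [b /= ub ba] : exists2 b, (\forall z \near x, u z <= b) & b < a.
  have [b ub bx] := inf_adherent (eps := a - usc_env u x) ltac:(by rewrite subr_gt0)
    (conj (env_ex x) (ex_intro _ _ (@env_lb x))).
  by exists b => //; rewrite (lt_le_trans bx)// addrC subrK.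
have := nbhs_interior ub; apply: filterS => z uz.
by apply: le_lt_trans ba; exact: usc_env_le.
Qed.

Lemma usc_env_approx x e (V : set T) : 0 < e -> nbhs x V ->
  exists2 z, V z & usc_env u x - e < u z.
Proof.
move=> e0 xV; apply: contrapT => nz.
have : usc_env u x <= usc_env u x - e; last by lra.
apply: usc_env_le; apply: filterS xV => z Vz; rewrite leNgt; apply/negP => uz.
by apply: nz; exists z.
Qed.

End usc_envelope.

Section stability.
Context {R : realType} {n : nat}.
Implicit Types (x y z p : 'rV[R]_n) (w : 'rV[R]_n -> R).

Lemma usc_delta_limsup (U : 'rV[R]_n -> R) (w_ : nat -> 'rV[R]_n -> R)
    (x_ : nat -> 'rV[R]_n) (x0 : 'rV[R]_n) :
  usc_real U -> (forall k x, w_ k x <= U x) ->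
  x_ @ \oo --> x0 -> (fun k => w_ k (x_ k)) @ \oo --> U x0 ->
  forall y e, 0 < e -> \forall k \near \oo, delta (w_ k) (x_ k) y <= delta U x0 y + e.
Proof.
move=> uU wU xx0 wx y e e0.
have e4 : 0 < e / 4 by lra.
have near_add z : \forall k \near \oo, U (x_ k + z) < U (x0 + z) + e / 4.
  have := uU (x0 + z) (U (x0 + z) + e / 4) ltac:(by rewrite ltrDl).
  have : (fun k => x_ k + z) @ \oo --> x0 + z by apply: cvgD => //; exact: cvg_cst.
  exact.
have near_c : \forall k \near \oo, U x0 - e / 4 <= w_ k (x_ k).
  have : \forall k \near \oo, `|U x0 - w_ k (x_ k)| <= e / 4.
    by move/cvgrPdist_le : wx; exact.
  by apply: filterS => k; rewrite ler_norml; lra.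
near=> k.
have h1 : U (x_ k + y) < U (x0 + y) + e / 4 by near: k; exact: near_add.
have h2 : U (x_ k - y) < U (x0 - y) + e / 4 by near: k; exact: near_add.
have h3 : U x0 - e / 4 <= w_ k (x_ k) by near: k.
have := wU k (x_ k + y); have := wU k (x_ k - y); rewrite /delta; lra.
Unshelve. all: by end_near. Qed.

Variables (sigma : R) (F : R -> R) (L : R).
Hypothesis sigma_12 : 1 < sigma < 2.
Hypotheses (F_incr : {homo F : s t / s <= t}) (F_0 : F 0 = 0).
Hypothesis F_lip : forall s t, `|F s - F t| <= L * `|s - t|.
Local Notation J := (second_order_integral sigma).

(** The common opening [B] of the paraboloids is what bounds the second
    differences from above uniformly, as Fatou's lemma requires; the upper
    semicontinuity of the limit controls them pointwise. *)
Lemma subsol_stability (U : 'rV[R]_n -> R) (w_ : nat -> 'rV[R]_n -> R)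
    (x_ p_ : nat -> 'rV[R]_n) (x0 : 'rV[R]_n) (B r : R) (c : nat -> R) (c0 : R) :
  0 < r -> 0 <= B ->
  usc_real U -> (forall k, measurable_fun setT (w_ k)) ->
  (forall k x, w_ k x <= U x) -> linear_growth U B ->
  x_ @ \oo --> x0 -> (fun k => w_ k (x_ k)) @ \oo --> U x0 ->
  (forall k, `|x_ k| <= B) -> (forall k, - w_ k (x_ k) <= B) ->
  (forall k, quad_above (w_ k) (x_ k) (p_ k) B r) ->
  c @ \oo --> c0 -> (forall k, ((c k)%:E <= J F (delta (w_ k) (x_ k)))%E) ->
  (c0%:E <= J F (delta U x0))%E.
Proof.
move=> r0 B0 uU mw wU UB xx0 wx xB wB wq cc0 cJ.
have [C C0 hC] := @le_delta_growth R n B r B0 r0.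
apply: (second_order_integral_limsup sigma_12 F_incr F_0 F_lip
  (d_ := fun k => delta (w_ k) (x_ k)) C0 _ _ _ _ cc0 cJ).
- by move=> k; exact: measurable_delta.
- by apply: measurable_delta; exact: usc_measurable.
- move=> k y; apply: (hC _ _ (p_ k)) => // z.
  exact: le_trans (wU k z) (UB z).
- exact: usc_delta_limsup.
Qed.

Lemma supersol_stability (V : 'rV[R]_n -> R) (w_ : nat -> 'rV[R]_n -> R)
    (x_ p_ : nat -> 'rV[R]_n) (x0 : 'rV[R]_n) (B r : R) (c : nat -> R) (c0 : R) :
  0 < r -> 0 <= B ->
  usc_real (\- V) -> (forall k, measurable_fun setT (w_ k)) ->
  (forall k x, V x <= w_ k x) -> linear_growth (\- V) B ->
  x_ @ \oo --> x0 -> (fun k => w_ k (x_ k)) @ \oo --> V x0 ->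
  (forall k, `|x_ k| <= B) -> (forall k, w_ k (x_ k) <= B) ->
  (forall k, quad_above (\- w_ k) (x_ k) (p_ k) B r) ->
  c @ \oo --> c0 -> (forall k, (J F (delta (w_ k) (x_ k)) <= (c k)%:E)%E) ->
  (J F (delta V x0) <= c0%:E)%E.
Proof.
move=> r0 B0 uV mw wV VB xx0 wx xB wB wq cc0 cJ.
have [C C0 hC] := @le_delta_growth R n B r B0 r0.
apply: (second_order_integral_liminf sigma_12 F_incr F_0 F_lip
  (d_ := fun k => delta (w_ k) (x_ k)) C0 _ _ _ _ cc0 cJ).
- by move=> k; exact: measurable_delta.
- apply: measurable_delta.
  have -> : V = (\- (\- V)) by apply/funext => z /=; rewrite opprK.
  by apply: measurable_funN; exact: usc_measurable.
- move=> k y; rewrite -deltaN; apply: (hC _ _ (p_ k)) => //=.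
    by rewrite opprK.
  by move=> z; apply: le_trans (VB z); rewrite /= lerN2.
- move=> y e e0.
  have := @usc_delta_limsup (\- V) (fun k => \- w_ k) x_ x0 uV _ xx0 _ y e e0.
  have cN : (fun k => - w_ k (x_ k)) @ \oo --> - V x0 by exact: cvgN.
  have wN k x : (\- w_ k) x <= (\- V) x by rewrite /= lerN2.
  move=> /(_ wN cN); apply: filterS => k.
  by rewrite !deltaN; lra.
Qed.

End stability.

(** * Perron's method *)

Lemma cvg_divS (R : realType) (c : R) : (fun k => c / k.+1%:R) @ \oo --> (0 : R).
Proof.
rewrite -[X in _ --> X](mulr0 c); apply: cvgM; first exact: cvg_cst.
exact: cvg_harmonic.
Qed.

Lemma cvg_sqn0 (R : realType) n (y_ : nat -> 'rV[R]_n) (e_ : nat -> R) :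
  (forall k, sqn (y_ k) <= e_ k) -> e_ @ \oo --> (0 : R) ->
  y_ @ \oo --> (0 : 'rV[R]_n).
Proof.
move=> ye e0; apply/cvgrPdist_le => t t0; rewrite /= in t0 *.
have t2 : 0 < t ^+ 2 by rewrite exprn_gt0.
have : \forall k \near \oo, `|0 - e_ k| <= t ^+ 2 by move/cvgrPdist_le : e0; exact.
apply: filterS => k; rewrite !sub0r !normrN => ek.
rewrite -ler_sqr ?nnegrE ?(ltW t0)// (le_trans (sqr_norm_le_sqn _))//.
by rewrite (le_trans (ye k))// (le_trans (ler_norm _)).
Qed.

Section perron.
Context {R : realType} {n : nat}.
Variables (sigma mu L M N : R) (F : R -> R) (g : 'rV[R]_n -> R -> R)
  (phi : 'rV[R]_n -> R).
Hypothesis sigma_12 : 1 < sigma < 2.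
Hypotheses (F_incr : {homo F : s t / s <= t}) (F_0 : F 0 = 0).
Hypothesis F_lip : forall s t, `|F s - F t| <= L * `|s - t|.
Hypothesis mu_gt0 : 0 < mu.
Hypothesis g_cont : continuous (fun q : 'rV[R]_n * R => g q.1 q.2).
Hypotheses (N_ge0 : 0 <= N)
  (g_lip : forall x y t, `|g x t - g y t| <= N * `|x - y|).
Hypothesis g_mono : forall x s t, s < t -> mu * (t - s) <= g x t - g x s.
Hypothesis g_0 : forall x, g x 0 = 0.
Hypotheses (phi_convex : convex_function setT phi) (phi_C11 : C11 setT phi).
Hypotheses (M_ge0 : 0 <= M) (phi_lip : forall x y, `|phi x - phi y| <= M * `|x - y|).
Hypothesis phi_cone : close_to_cone phi.
Implicit Types (x y z p : 'rV[R]_n) (u v w : 'rV[R]_n -> R).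
Local Notation J := (second_order_integral sigma).
Local Notation rhs w := (fun x => g x (w x - phi x)).

Let phi_cont : continuous phi := continuous_obstacle phi_lip.

(** The lower bound by the obstacle gives one half of the decay at infinity and the
    linear growth from below; the last condition makes comparison applicable. *)
Definition perron_class w : Prop :=
  [/\ usc_real w, pointwise_subsol sigma F w (rhs w), (forall x, phi x <= w x) &
      forall e, 0 < e -> exists r, forall x, r < `|x| -> w x - phi x <= e].

Let obstacle_perron : perron_class phi.
Proof.
split=> //.
- exact: continuous_usc.
- move=> x p K r r0 _; rewrite subrr g_0; apply: integral_ge0 => y _.
  rewrite lee_fin divr_ge0 ?kernel_ge0// -F_0; apply: F_incr.
  exact: delta_convex_ge0.
- by move=> e e0; exists 0 => x _; rewrite subrr ltW.
Qed.

(** By comparison one barrier dominates the whole class, so the supremum is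
    finite and inherits the decay. *)
Lemma perron_class_barrier e : 0 < e -> exists psi : 'rV[R]_n -> R,
  [/\ continuous psi, (forall x, 0 <= psi x),
      exists r, forall x, r < `|x| -> psi x <= e &
      forall w, perron_class w -> forall x, w x <= phi x + psi x].
Proof.
move=> e0; have [psi [cpsi psi0 psi_oo psiJ]] := barrier sigma_12 F_incr F_0 F_lip
  mu_gt0 g_mono g_0 phi_convex phi_C11 M_ge0 phi_lip phi_cone e0.
exists psi; split => // w [uw subw phiw w_oo].
apply: (comparison F_incr mu_gt0 M_ge0 N_ge0 phi_lip g_lip g_mono uw _ subw) => //.
- apply: continuous_usc => x; apply: (@cvgN _ _ _ (nbhs x)).
  by apply: (@cvgD _ _ _ (nbhs x)); [exact: phi_cont|exact: cpsi].
- by move=> x p K r r0 _; rewrite [phi x + _]addrC addrK; exact: psiJ.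
- move=> t t0; exists 0 => x _; rewrite [phi x + _]addrC addrK.
  by rewrite (le_trans _ (psi0 x))// oppr_le0 ltW.
Qed.

Definition perron_sup x : R := sup [set t | exists2 w, perron_class w & w x = t].

Let perron_has_sup x : has_sup [set t | exists2 w, perron_class w & w x = t].
Proof.
split; first by exists (phi x), phi.
have [psi [_ _ _ wpsi]] := perron_class_barrier ltr01.
by exists (phi x + psi x) => _ [w /wpsi wx <-].
Qed.

Lemma perron_sup_ge w x : perron_class w -> w x <= perron_sup x.
Proof. by move=> Sw; apply: ub_le_sup; [case: (perron_has_sup x)|exists w]. Qed.

Lemma perron_sup_le x (a : R) : (forall w, perron_class w -> w x <= a) -> perron_sup x <= a.
Proof.
move=> wa; apply: sup_le_ub; first by case: (perron_has_sup x).
by move=> _ [w Sw <-]; exact: wa.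
Qed.

Lemma perron_sup_gt x (a : R) : a < perron_sup x -> exists2 w, perron_class w & a < w x.
Proof.
move=> ax; apply: contrapT => nw; have : perron_sup x <= a; last by rewrite leNgt ax.
apply: perron_sup_le => w Sw; rewrite leNgt; apply/negP => aw.
by apply: nw; exists w.
Qed.

Let W := usc_env perron_sup.

Let top : exists2 h : 'rV[R]_n -> R, usc_real h & forall x, perron_sup x <= h x.
Proof.
have [psi [cpsi _ _ wpsi]] := perron_class_barrier ltr01.
exists (fun x => phi x + psi x); last first.
  by move=> x; apply: perron_sup_le => w Sw; exact: wpsi.
apply: continuous_usc => x.
by apply: (@cvgD _ _ _ (nbhs x)); [exact: phi_cont|exact: cpsi].
Qed.

Let W_ge x : perron_sup x <= W x.
Proof. by have [h uh hx] := top; exact: usc_env_ge hx uh x. Qed.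

Let W_usc : usc_real W.
Proof. by have [h uh hx] := top; exact: usc_env_usc hx uh. Qed.

Let W_phi x : phi x <= W x.
Proof. exact: le_trans (perron_sup_ge x obstacle_perron) (W_ge x). Qed.

Let W_oo e : 0 < e -> exists r, forall x, r < `|x| -> W x - phi x <= e.
Proof.
move=> e0; have [psi [cpsi _ [r hr] wpsi]] := perron_class_barrier e0.
have upsi : usc_real (fun x => phi x + psi x).
  apply: continuous_usc => x.
  by apply: (@cvgD _ _ _ (nbhs x)); [exact: phi_cont|exact: cpsi].
have Wpsi x : W x <= phi x + psi x.
  apply: (usc_env_le_usc _ upsi) => z; apply: perron_sup_le => w Sw; exact: wpsi.
by exists r => x /hr; have := Wpsi x; lra.
Qed.

Let phi_linear x : `|phi x| <= `|phi 0| + M * `|x|.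
Proof.
have := phi_lip x 0; rewrite subr0 => h.
rewrite -[phi x in leLHS](subrK (phi 0)) addrC (le_trans (ler_normD _ _))//.
by rewrite lerD2l.
Qed.

Lemma linear_growth_obstacle w A : (forall x, w x - phi x <= A) ->
  exists2 B, 0 <= B & linear_growth w B.
Proof.
move=> wA; exists (`|A| + `|phi 0| + M) => [|x].
  by rewrite !addr_ge0.
have := wA x; have := phi_linear x; have := ler_norm (phi x); have := ler_norm A.
have x0 := normr_ge0 x; have A0 := normr_ge0 A; have p0 := normr_ge0 (phi 0).
have : 0 <= `|A| * `|x| by rewrite mulr_ge0.
have : 0 <= `|phi 0| * `|x| by rewrite mulr_ge0.
have M0 := M_ge0; lra.
Qed.

Let W_linear : exists2 B, 0 <= B & linear_growth W B.
Proof.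
have uWp : usc_real (fun x => W x - phi x).
  apply: usc_realD => //; apply: continuous_usc => x.
  by apply: (@cvgN _ _ _ (nbhs x)); exact: phi_cont.
have [r hr] := W_oo ltr01.
have [A A0 hA] := usc_bounded_above uWp hr.
exact: linear_growth_obstacle hA.
Qed.

Lemma cvg_rhs (x_ : nat -> 'rV[R]_n) (t_ : nat -> R) x0 t0 :
  x_ @ \oo --> x0 -> t_ @ \oo --> t0 ->
  (fun k => g (x_ k) (t_ k - phi (x_ k))) @ \oo --> g x0 (t0 - phi x0).
Proof.
move=> xx0 tt0.
have cp : (fun k => (x_ k, t_ k - phi (x_ k))) @ \oo --> (x0, t0 - phi x0).
  have ct : (fun k => t_ k - phi (x_ k)) @ \oo --> t0 - phi x0.
    by apply: cvgB => //; apply: continuous_cvg => //; exact: phi_cont.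
  exact: (@cvg_pair _ _ _ \oo (nbhs x0) (nbhs (t0 - phi x0)) _ _ _ _ _ xx0 ct).
have gc : {for (x0, t0 - phi x0), continuous (fun q : 'rV[R]_n * R => g q.1 q.2)}.
  exact: g_cont.
exact: (continuous_cvg _ gc cp).
Qed.

(** Near-maximizers: at a point where the upper envelope is touched by a
    paraboloid, members of the class that nearly attain the envelope are touched
    by translates of a slightly wider paraboloid at nearby points. *)
Lemma perron_near_maximizer x0 p K r e : 0 < r -> 0 < e ->
  quad_above W x0 p K r ->
  let Q y := dot p y + (K + 1) * sqn y in
  exists w y', [/\ perron_class w, sqn y' <= 2 * e,
    W x0 - 2 * e <= w (x0 + y') - Q y' <= W x0 &
    forall y, `|y| <= r / 2 -> w (x0 + y) - Q y <= w (x0 + y') - Q y'].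
Proof.
move=> r0 e0 Wq Q.
have r20 : 0 < r / 2 by lra.
have Qx : continuous (fun z => Q (z - x0)).
  have -> : (fun z => Q (z - x0)) = paraboloid 0 x0 p (K + 1).
    by apply/funext => z; rewrite /paraboloid /Q add0r.
  exact: continuous_paraboloid.
have nV : nbhs x0 [set z | `|z - x0| < r / 2 /\ Q (z - x0) < e].
  near=> z; split; near: z.
    have := nbhsx_ballx x0 _ r20; apply: filterS => z.
    by rewrite -ball_normE/= distrC.
  have := continuous_usc Qx (x := x0) (a := e); apply.
  by rewrite subrr /Q dot0r sqn0 mulr0 addr0.
have [z [zr Qz] Wz] := usc_env_approx perron_sup e0 nV.
have [w Sw wz] := perron_sup_gt Wz.
have [uw _ _ _] := Sw.
have uf : usc_real (fun y => w (x0 + y) - Q y).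
  apply: usc_realD.
    apply: (usc_real_comp (h := fun y => x0 + y) _ uw) => y.
    by apply: (@cvgD _ _ _ (nbhs y)); [exact: cvg_cst|exact: cvg_id].
  apply: continuous_usc => y; apply: (@cvgN _ _ _ (nbhs y)).
  have -> : Q = paraboloid 0 0 p (K + 1).
    by apply/funext => y'; rewrite /paraboloid /Q add0r subr0.
  exact: continuous_paraboloid.
have K0 : [set y : 'rV[R]_n | `|y| <= r / 2] !=set0.
  by exists 0; rewrite /= normr0 ltW.
have [y' y'r fmax] := usc_compact_max (@compact_norm_ball R n (r / 2)) K0 uf.
exists w, y'.
have low : W x0 - 2 * e <= w (x0 + y') - Q y'.
  apply: (le_trans _ (fmax (z - x0) (ltW zr))); rewrite /= subrKC.
  by move: wz Qz; rewrite -/W; lra.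
have up : w (x0 + y') - Q y' <= W x0 - sqn y'.
  have y'r2 : `|y'| < r by rewrite (le_lt_trans y'r)//; lra.
  have := Wq y' y'r2; have := le_trans (perron_sup_ge (x0 + y') Sw) (W_ge (x0 + y')).
  by rewrite /Q; lra.
have q0 := sqn_ge0 y'.
by split => //; [lra|apply/andP; split; lra].
Unshelve. all: by end_near. Qed.

(** The near-maximizers for errors tending to 0 are contact points that converge
    to [x0], with paraboloids of a common opening: stability applies. *)
Let W_subsol : pointwise_subsol sigma F W (rhs W).
Proof.
move=> x0 p K r r0 Wq.
(* makes the contact points lie in the ball of radius r / 4 *)
pose c := r ^+ 2 / 64.
have r2 : 0 < r ^+ 2 by rewrite exprn_gt0.
have c0 : 0 < c by rewrite divr_gt0.
pose e_ (k : nat) := c / k.+1%:R.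
have e0 k : 0 < e_ k by rewrite divr_gt0.
have ec k : e_ k <= c by rewrite ler_pdivrMr// ler_peMr ?ler1n// ltW.
pose Q y := dot p y + (K + 1) * sqn y.
have /choice[wy wyP] : forall k, exists q : ('rV[R]_n -> R) * 'rV[R]_n,
    [/\ perron_class q.1, sqn q.2 <= 2 * e_ k,
    W x0 - 2 * e_ k <= q.1 (x0 + q.2) - Q q.2 <= W x0 &
    forall y, `|y| <= r / 2 -> q.1 (x0 + y) - Q y <= q.1 (x0 + q.2) - Q q.2].
  move=> k; have [w [y' h]] := perron_near_maximizer r0 (e0 k) Wq.
  by exists (w, y').
pose w_ k := (wy k).1; pose y_ k := (wy k).2; pose x_ k := x0 + y_ k.
have wS k : perron_class (w_ k) by case: (wyP k).
have ysq k : sqn (y_ k) <= 2 * e_ k by case: (wyP k).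
have wW k x : w_ k x <= W x by exact: le_trans (perron_sup_ge x (wS k)) (W_ge x).
have yr k : `|y_ k| < r / 4.
  rewrite -ltr_sqr ?nnegrE ?divr_ge0 ?(ltW r0)//.
  rewrite (le_lt_trans (sqr_norm_le_sqn _))// (le_lt_trans (ysq k))//.
  have -> : (r / 4) ^+ 2 = r ^+ 2 / 16 by field.
  by have := ec k; rewrite /c; lra.
have e_cvg : e_ @ \oo --> (0 : R) by exact: cvg_divS.
have e2_cvg : (fun k => 2 * e_ k) @ \oo --> (0 : R).
  rewrite -[X in _ --> X](mulr0 2); apply: cvgM => //; exact: cvg_cst.
have y_cvg : y_ @ \oo --> (0 : 'rV[R]_n) by exact: cvg_sqn0 ysq e2_cvg.
have x_cvg : x_ @ \oo --> x0.
  by rewrite -[X in _ --> X]addr0; apply: cvgD => //; exact: cvg_cst.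
have Q_cont : continuous Q.
  have -> : Q = paraboloid 0 0 p (K + 1).
    by apply/funext => y'; rewrite /paraboloid /Q add0r subr0.
  exact: continuous_paraboloid.
have Q_cvg : (fun k => Q (y_ k)) @ \oo --> (0 : R).
  have <- : Q 0 = 0 by rewrite /Q dot0r sqn0 mulr0 addr0.
  by apply: continuous_cvg => //; exact: Q_cont.
have wx_cvg : (fun k => w_ k (x_ k)) @ \oo --> W x0.
  have h : (fun k => w_ k (x_ k) - Q (y_ k)) @ \oo --> W x0.
    apply/cvgrPdist_le => t t0.
    have : \forall k \near \oo, `|0 - 2 * e_ k| <= t by move/cvgrPdist_le : e2_cvg; exact.
    apply: filterS => k; rewrite sub0r normrN => /(le_trans (ler_norm _)) ek.
    have [_ _ /andP[h1 h2] _] := wyP k; rewrite -/(w_ k) -/(y_ k) -/(x_ k) in h1 h2.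
    by rewrite ler_norml; apply/andP; split; lra.
  have -> : (fun k => w_ k (x_ k)) = (fun k => (w_ k (x_ k) - Q (y_ k)) + Q (y_ k)).
    by apply/funext => k; rewrite subrK.
  by rewrite -[X in _ --> X]addr0; exact: cvgD.
have [B0 B00 WB] := W_linear.
pose B := B0 + `|x0| + r + `|phi 0| + M * (`|x0| + r) + `|K| + 1.
have n1 := normr_ge0 x0; have n2 := normr_ge0 (phi 0); have n3 := normr_ge0 K.
have n4 : 0 <= M * (`|x0| + r) by rewrite mulr_ge0// addr_ge0// ltW.
have Bge0 : 0 <= B by rewrite /B; lra.
have B0B : B0 <= B by rewrite /B; lra.
have xb k : `|x_ k| <= `|x0| + r.
  by rewrite (le_trans (ler_normD _ _))// lerD2l; have := yr k; lra.
have quad k : quad_above (w_ k) (x_ k) (p + (2 * (K + 1)) *: y_ k) (K + 1) (r / 4).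
  move=> y yr4; have [_ _ _ /(_ (y_ k + y))] := wyP k.
  rewrite -/(w_ k) -/(y_ k) addrA -/(x_ k) => h.
  have /h : `|y_ k + y| <= r / 2.
    by rewrite (le_trans (ler_normD _ _))//; have := yr k; lra.
  by rewrite /Q sqnD dotDr dotDl dotZl; lra.
apply: (@subsol_stability _ _ sigma F L sigma_12 F_incr F_0 F_lip W w_ x_
  (fun k => p + (2 * (K + 1)) *: y_ k) x0 B (r / 4)
  (fun k => g (x_ k) (w_ k (x_ k) - phi (x_ k)))) => //.
- by rewrite divr_gt0.
- by move=> k; case: (wS k) => uw _ _ _; exact: usc_measurable.
- by move=> z; apply: (le_trans (WB z)); rewrite ler_wpM2r// addr_ge0.
- by move=> k; apply: (le_trans (xb k)); rewrite /B; lra.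
- move=> k; case: (wS k) => _ _ /(_ (x_ k)) pw _.
  have := phi_linear (x_ k); have := ler_norm (- phi (x_ k)); rewrite normrN.
  have M0 : 0 <= M := M_ge0; have := ler_wpM2l M0 (xb k).
  by rewrite /B; lra.
- move=> k; apply: (@quad_above_le _ _ _ _ _ (K + 1)).
    by have := ler_norm K; rewrite /B; lra.
  exact: quad.
- exact: cvg_rhs.
- move=> k; case: (wS k) => _ subw _ _; apply: (subw _ (p + (2 * (K + 1)) *: y_ k) (K + 1) (r / 4)).
    by rewrite divr_gt0.
  exact: quad.
Qed.

Lemma perron_sup_class : perron_class perron_sup.
Proof.
have SW : perron_class W by split.
have WE : W = perron_sup.
  apply/funext => x; apply/eqP; rewrite eq_le W_ge andbT.
  exact: perron_sup_ge SW.
by rewrite -WE.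
Qed.

(** The lift of Perron's method. When [P] lies below [u] near the boundary of the
    ball, the cut-off is invisible and the lift stays upper semicontinuous. *)
Definition bump_up u x0 (r : R) (P : 'rV[R]_n -> R) z : R :=
  if `|z - x0| < r then Num.max (u z) (P z) else u z.

Lemma bump_up_usc u x0 r P : usc_real u -> 0 < r -> continuous P ->
  (forall z, r / 2 <= `|z - x0| -> `|z - x0| < r -> P z <= u z) ->
  usc_real (bump_up u x0 r P).
Proof.
move=> uu r0 cP Pout; set w := bump_up u x0 r P.
have wout z : r / 2 <= `|z - x0| -> w z = u z.
  move=> zr; rewrite /w /bump_up; case: ifPn => // zr'.
  by apply/max_idPl; exact: Pout.
have cd : continuous (fun z : 'rV[R]_n => `|z - x0|).
  move=> z; apply: (@cvg_norm _ _ _ (nbhs z)).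
  by apply: (@cvgB _ _ _ (nbhs z)); [exact: cvg_id|exact: cvg_cst].
move=> x a xa; have [xr|xr] := ltP `|x - x0| r.
  have umax : usc_real (u \max P) by apply: usc_real_max => //; exact: continuous_usc.
  have xa' : (u \max P) x < a by move: xa; rewrite /w /bump_up xr.
  near=> z.
  have zr : `|z - x0| < r by near: z; exact: continuous_usc cd _ _ xr.
  by rewrite /w /bump_up zr; near: z; exact: umax.
have xr2 : - `|x - x0| < - (r / 2) by lra.
have ua : u x < a by rewrite -wout// ; lra.
near=> z.
have zr : - `|z - x0| < - (r / 2).
  near: z; apply: (continuous_usc (w := fun z => - `|z - x0|)) => // z.
  by apply: (@cvgN _ _ _ (nbhs z)); exact: cd.
rewrite wout; last by lra.
by near: z; exact: uu.
Unshelve. all: by end_near. Qed.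

Lemma bump_up_class u x0 r P : perron_class u -> 0 < r -> continuous P ->
  (forall z, r / 2 <= `|z - x0| -> `|z - x0| < r -> P z <= u z) ->
  (forall x, `|x - x0| < r -> u x < P x ->
    ((g x (P x - phi x))%:E <= J F (delta (bump_up u x0 r P) x))%E) ->
  perron_class (bump_up u x0 r P).
Proof.
move=> [uu subu phiu u_oo] r0 cP Pout sub.
set w := bump_up u x0 r P.
have uw z : u z <= w z.
  by rewrite /w /bump_up; case: ifP => _; rewrite ?le_max lexx.
have wout z : r / 2 <= `|z - x0| -> w z = u z.
  move=> zr; rewrite /w /bump_up; case: ifPn => // zr'.
  by apply/max_idPl; exact: Pout.
split.
- exact: bump_up_usc.
- move=> x p K r' r'0 wq.
  have [[xr ux]|nx] := pselect (`|x - x0| < r /\ u x < P x).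
    have -> : w x = P x by rewrite /w /bump_up xr; apply/max_idPr; exact: ltW.
    exact: sub.
  have wx : w x = u x.
    rewrite /w /bump_up; case: ifP => // xr; apply/max_idPl.
    by rewrite leNgt; apply/negP => ux; apply: nx.
  rewrite wx; apply: (@le_trans _ _ (J F (delta u x))).
    apply: (subu x p K r') => // y yr; rewrite -wx.
    by apply: le_trans (wq y yr); exact: uw.
  apply: le_second_order_integral => // y; rewrite /delta wx.
  by have := uw (x + y); have := uw (x - y); lra.
- by move=> x; exact: le_trans (uw x).
- move=> e e0; have [r1 hr1] := u_oo e e0.
  exists (Num.max r1 (`|x0| + r)) => x; rewrite gt_max => /andP[xr1 xr].
  rewrite wout; first exact: hr1.
  by have := lerB_dist x x0; lra.
Unshelve. all: by end_near. Qed.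

Let V x := - usc_env (fun z => - perron_sup z) x.

Let Nphi_usc : usc_real (fun x => - phi x).
Proof.
by apply: continuous_usc => x; apply: (@cvgN _ _ _ (nbhs x)); exact: phi_cont.
Qed.

Let Nu_phi x : - perron_sup x <= - phi x.
Proof. by rewrite lerN2; case: perron_sup_class => _ _ /(_ x). Qed.

Let V_le x : V x <= perron_sup x.
Proof. by rewrite /V lerNl; exact: (usc_env_ge Nu_phi Nphi_usc). Qed.

Let V_phi x : phi x <= V x.
Proof. by rewrite /V lerNr; exact: (usc_env_le_usc Nu_phi Nphi_usc). Qed.

Let V_lsc : usc_real (\- V).
Proof.
have -> : (\- V) = usc_env (fun z => - perron_sup z).
  by apply/funext => x /=; rewrite /V opprK.
exact: usc_env_usc Nu_phi Nphi_usc.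
Qed.

(** A paraboloid touching the lower envelope from below, narrowed slightly and
    raised by s > 0, exceeds the supremum near the contact point. The lift can
    therefore not belong to the class, so it violates the subsolution inequality
    at some point; these points tend to the contact point as s tends to 0, and the
    reversed inequality passes to the limit. *)
Let V_supersol : pointwise_supersol sigma F V (rhs V).
Proof.
move=> x0 p K r r0 Vq.
have Su := perron_sup_class.
pose P (s : R) := paraboloid (V x0 + s) x0 (- p) (- (K + 1)).
have PV s y : `|y| < r -> P s (x0 + y) <= V (x0 + y) - sqn y + s.
  move=> yr; have /= := Vq y yr; rewrite /P /paraboloid.
  by rewrite (_ : x0 + y - x0 = y) ?dotNl; [lra|rewrite addrC addKr].
(* [s_ k <= c] keeps the raised paraboloid below [V] for r / 2 <= |y| and the
   points [y_ k] in the ball of radius r / 4 *)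
pose c := r ^+ 2 / 16.
have r2 : 0 < r ^+ 2 by rewrite exprn_gt0.
have c0 : 0 < c by rewrite divr_gt0.
pose s_ (k : nat) := c / k.+1%:R.
have s0 k : 0 < s_ k by rewrite divr_gt0.
have sc k : s_ k <= c by rewrite ler_pdivrMr// ler_peMr ?ler1n// ltW.
pose w_ k := bump_up perron_sup x0 r (P (s_ k)).
have Pout k z : r / 2 <= `|z - x0| -> `|z - x0| < r -> P (s_ k) z <= perron_sup z.
  move=> zr zr'; have := PV (s_ k) _ zr'; rewrite subrKC.
  have : (r / 2) ^+ 2 <= sqn (z - x0).
    by apply: le_trans (sqr_norm_le_sqn _); rewrite ler_sqr ?nnegrE ?divr_ge0 ?(ltW r0).
  have -> : (r / 2) ^+ 2 = r ^+ 2 / 4 by field.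
  by have := V_le z; have := sc k; rewrite /c; lra.
(* a lift in the class would push the lower envelope above its value at [x0] *)
have /choice[x_ xP] : forall k, exists x, [/\ `|x - x0| < r, perron_sup x < P (s_ k) x &
    (J F (delta (w_ k) x) <= (g x (P (s_ k) x - phi x))%:E)%E].
  move=> k; apply: contrapT => nx.
  have Sw : perron_class (w_ k).
    apply: bump_up_class => //; [exact: continuous_paraboloid|exact: Pout|].
    move=> x xr ux; rewrite leNgt; apply/negP => Jg; apply: nx; exists x; split => //.
    exact: ltW.
  have : usc_env (fun z => - perron_sup z) x0 <= - V x0 - s_ k / 2.
    apply: usc_env_le; near=> z.
    have zr : `|z - x0| < r.
      near: z; have := nbhsx_ballx x0 _ r0; apply: filterS => z.
      by rewrite -ball_normE/= distrC.
    have Pz : - P (s_ k) z < - V x0 - s_ k / 2.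
      near: z; apply: (continuous_usc (w := fun z => - P (s_ k) z)).
        move=> z; apply: (@cvgN _ _ _ (nbhs z)); exact: continuous_paraboloid.
      have := s0 k.
      by rewrite /P /paraboloid subrr dot0r sqn0 mulr0 !addr0; lra.
    have := perron_sup_ge z Sw; rewrite /w_ /bump_up zr ge_max => /andP[_].
    by lra.
  by have := s0 k; rewrite /V; lra.
pose y_ k := x_ k - x0.
have xy k : x_ k = x0 + y_ k by rewrite subrKC.
have yr k : `|y_ k| < r by case: (xP k).
have ysq k : sqn (y_ k) <= s_ k.
  have [_ uP _] := xP k; have := PV (s_ k) _ (yr k); rewrite -xy.
  by have := V_le (x_ k); lra.
have yr4 k : `|y_ k| <= r / 4.
  rewrite -ler_sqr ?nnegrE ?divr_ge0 ?(ltW r0)//.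
  rewrite (le_trans (sqr_norm_le_sqn _))// (le_trans (ysq k))//.
  have -> : (r / 4) ^+ 2 = r ^+ 2 / 16 by field.
  exact: sc.
have s_cvg : s_ @ \oo --> (0 : R) by exact: cvg_divS.
have y_cvg : y_ @ \oo --> (0 : 'rV[R]_n) by exact: cvg_sqn0 ysq s_cvg.
have x_cvg : x_ @ \oo --> x0.
  have -> : x_ = (fun k => x0 + y_ k) by apply/funext.
  by rewrite -[X in _ --> X]addr0; apply: cvgD => //; exact: cvg_cst.
have wx k : w_ k (x_ k) = P (s_ k) (x_ k).
  have [xr uP _] := xP k; rewrite /w_ /bump_up xr.
  by apply/max_idPr; exact: ltW.
have wx_cvg : (fun k => w_ k (x_ k)) @ \oo --> V x0.
  have -> : (fun k => w_ k (x_ k)) = (fun k => P 0 (x_ k) + s_ k).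
    by apply/funext => k; rewrite wx /P /paraboloid; ring.
  rewrite -[X in _ --> X]addr0; apply: cvgD => //.
  have <- : P 0 x0 = V x0 by rewrite /P /paraboloid subrr dot0r sqn0 mulr0 !addr0.
  by apply: continuous_cvg => //; exact: continuous_paraboloid.
have Vw k x : V x <= w_ k x.
  apply: (le_trans (V_le x)); rewrite /w_ /bump_up; case: ifP => _ //.
  by rewrite le_max lexx.
have n1 := normr_ge0 x0; have n2 := normr_ge0 (phi 0); have n3 := normr_ge0 K.
have n5 := normr_ge0 (V x0); have n6 := normr_ge0 p.
have n7 : 0 <= n%:R * (`|p| * r) by rewrite mulr_ge0// mulr_ge0// ltW.
have n8 : 0 <= (`|K| + 1) * (n%:R * r ^+ 2) by apply: mulr_ge0; [lra|rewrite mulr_ge0// ltW].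
have M0 : 0 <= M := M_ge0.
pose B := `|phi 0| + M + `|x0| + r + `|V x0| + c + n%:R * (`|p| * r)
  + (`|K| + 1) * (n%:R * r ^+ 2) + `|K| + 1.
have B0 : 0 <= B by rewrite /B; lra.
have quad k : quad_above (\- w_ k) (x_ k) (p + (2 * (K + 1)) *: y_ k) (K + 1) (r / 4).
  move=> y yr2 /=.
  have zr : `|x_ k + y - x0| < r.
    have -> : x_ k + y - x0 = y_ k + y by rewrite addrAC.
    by rewrite (le_lt_trans (ler_normD _ _))//; have := yr4 k; lra.
  have h : P (s_ k) (x_ k + y) <= w_ k (x_ k + y).
    by rewrite /w_ /bump_up zr le_max lexx orbT.
  move: h; rewrite {1}/P paraboloidD -/(P (s_ k) (x_ k)) -wx -/(y_ k).
  by rewrite !dotDl !dotNl !dotZl; lra.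
apply: (@supersol_stability _ _ sigma F L sigma_12 F_incr F_0 F_lip V w_ x_
  (fun k => p + (2 * (K + 1)) *: y_ k) x0 B (r / 4)
  (fun k => g (x_ k) (w_ k (x_ k) - phi (x_ k)))) => //.
- by rewrite divr_gt0.
- move=> k; apply: usc_measurable.
  by apply: bump_up_usc => //; [case: Su|exact: continuous_paraboloid|exact: Pout].
- move=> z /=; have := V_phi z; have := phi_linear z; have := ler_norm (- phi z).
  rewrite normrN.
  have z0 := normr_ge0 z.
  have : (`|phi 0| + M) * (1 + `|z|) <= B * (1 + `|z|).
    by rewrite ler_wpM2r ?addr_ge0// /B; lra.
  have : 0 <= `|phi 0| * `|z| by rewrite mulr_ge0.
  by lra.
- move=> k; rewrite xy (le_trans (ler_normD _ _))//.
  by have := yr k; rewrite /B; lra.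
- move=> k; rewrite wx /P /paraboloid -/(y_ k).
  have h1 : dot (- p) (y_ k) <= n%:R * (`|p| * r).
    rewrite (le_trans (ler_norm _))// (le_trans (dot_le _ _))// normrN.
    by rewrite !ler_wpM2l// ltW.
  have h2 : - (K + 1) * sqn (y_ k) <= (`|K| + 1) * (n%:R * r ^+ 2).
    apply: (@le_trans _ _ ((`|K| + 1) * sqn (y_ k))).
      rewrite ler_wpM2r ?sqn_ge0//; have := ler_norm (- K); rewrite normrN; lra.
    rewrite ler_wpM2l ?addr_ge0// (le_trans (sqn_le _))// ler_wpM2l//.
    by rewrite ler_sqr ?nnegrE ?(ltW r0)// ltW.
  by have := ler_norm (V x0); have := sc k; rewrite /B; lra.
- move=> k; apply: (@quad_above_le _ _ _ _ _ (K + 1)); last exact: quad.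
  by have := ler_norm K; rewrite /B; lra.
- exact: cvg_rhs.
- by move=> k; rewrite wx; case: (xP k).
Unshelve. all: by end_near. Qed.

(** The largest subsolution and its lower envelope are ordered by comparison,
    hence equal. *)
Lemma perron_solution : exists u, [/\ continuous u,
  pointwise_subsol sigma F u (rhs u), pointwise_supersol sigma F u (rhs u),
  (forall x, phi x <= u x) &
  forall e, 0 < e -> exists r, forall x, r < `|x| -> u x - phi x <= e].
Proof.
have [uu subu phiu u_oo] := perron_sup_class.
have uV x : perron_sup x <= V x.
  apply: (comparison F_incr mu_gt0 M_ge0 N_ge0 phi_lip g_lip g_mono uu V_lsc subu V_supersol u_oo).
  by move=> e e0; exists 0 => z _; have := V_phi z; lra.
have E : V = perron_sup.
  by apply/funext => x; apply/eqP; rewrite eq_le V_le uV.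
exists perron_sup; split => //; last by rewrite -E.
move=> x; apply/(@cvgrPdist_lt _ _ _ (nbhs x)) => e e0.
near=> z.
have h1 : perron_sup z < perron_sup x + e by near: z; apply: uu; rewrite ltrDl.
have h2 : - perron_sup z < - perron_sup x + e.
  near: z; rewrite -E; apply: (V_lsc (x := x)); by rewrite ltrDl.
by rewrite ltr_norml; apply/andP; split; lra.
Unshelve. all: by end_near. Qed.

End perron.

(** * Existence and uniqueness *)

Section viscosity_solutions.
Context {R : realType} {n : nat}.
Variables (sigma mu L M N : R) (F : R -> R) (g : 'rV[R]_n -> R -> R)
  (phi : 'rV[R]_n -> R).
Hypothesis sigma_12 : 1 < sigma < 2.
Hypotheses (F_incr : {homo F : s t / s <= t}) (F_0 : F 0 = 0).
Hypothesis F_lip : forall s t, `|F s - F t| <= L * `|s - t|.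
Hypothesis mu_gt0 : 0 < mu.
Hypotheses (N_ge0 : 0 <= N)
  (g_lip : forall x y t, `|g x t - g y t| <= N * `|x - y|).
Hypothesis g_mono : forall x s t, s < t -> mu * (t - s) <= g x t - g x s.
Hypotheses (M_ge0 : 0 <= M) (phi_lip : forall x y, `|phi x - phi y| <= M * `|x - y|).
Implicit Types (x y z p : 'rV[R]_n) (u v w : 'rV[R]_n -> R).
Local Notation rhs w := (fun x => g x (w x - phi x)).

Lemma weighted_L1_linear_growth w B : measurable_fun setT w ->
  (forall z, `|w z| <= B * (1 + `|z|)) -> weighted_L1 sigma w.
Proof.
move=> mw wB.
apply: (@le_integrable _ _ _ _ _ measurableT _
  (fun y => B%:E * ((1 + `|y|) / (1 + enorm y) `^ (n%:R + sigma))%:E)%E).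
- apply/measurable_EFinP; apply: measurable_funM => //.
  under eq_fun do rewrite -powRN.
  apply: (measurableT_comp (measurable_powR _)); apply: measurable_funD => //.
  by apply: continuous_measurable_rV; exact: continuous_enorm.
- move=> y _; rewrite -EFinM !abse_EFin lee_fin mulrA [leLHS]normrM [leRHS]normrM.
  by rewrite ler_wpM2r// (le_trans (wB y))// ler_norm.
- by apply: integrableZl => //; exact: integrable_weight.
Qed.

Lemma vanishes_norm w e : vanishes_at_infinity w -> 0 < e ->
  exists r, forall x, r < `|x| -> `|w x| <= e.
Proof.
move=> w0 e0; have [r hr] := w0 e e0; exists r => x xr.
by apply/ltW/hr; rewrite (lt_le_trans xr)// norm_le_enorm.
Qed.

Lemma norm_vanishes w :
  (forall e, 0 < e -> exists r, forall x, r < `|x| -> `|w x| <= e) ->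
  vanishes_at_infinity w.
Proof.
move=> w0 e e0; have [|r hr] := w0 (e / 2); first by lra.
exists (n%:R * `|r|) => x xr.
have : n%:R * `|r| < n%:R * `|x| by rewrite (lt_le_trans xr)// enorm_le_norm.
rewrite ltNge => nrx; have rx : r < `|x|.
  rewrite ltNge; apply: contra nrx => xr'.
  by rewrite ler_wpM2l// (le_trans xr')// ler_norm.
by have := hr x rx; lra.
Qed.

Lemma visc_sol_le u v :
  visc_sol F sigma setT u (rhs u) -> vanishes_at_infinity (fun x => u x - phi x) ->
  visc_sol F sigma setT v (rhs v) -> vanishes_at_infinity (fun x => v x - phi x) ->
  forall x, u x <= v x.
Proof.
move=> [subu _] u_oo [_ supv] v_oo.
have [/usc_realP uu _ _] := subu; have [/lscP uv _ _] := supv.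
have phic : usc_real (fun x => - phi x).
  apply: continuous_usc => x; apply: (@cvgN _ _ _ (nbhs x)).
  exact: (lipschitz_continuous_rV phi_lip).
have u_oo' e : 0 < e -> exists r, forall x, r < `|x| -> u x - phi x <= e.
  move=> e0; have [r hr] := vanishes_norm u_oo e0; exists r => x /hr.
  exact: le_trans (ler_norm _).
have v_oo' e : 0 < e -> exists r, forall x, r < `|x| -> - e <= v x - phi x.
  move=> e0; have [r hr] := vanishes_norm v_oo e0; exists r => x /hr.
  by rewrite ler_norml => /andP[].
have [r1 hr1] := u_oo' _ ltr01; have [r2 hr2] := v_oo' _ ltr01.
have [A1 _ hA1] := usc_bounded_above (usc_realD uu phic) hr1.
have [B1 _ uB] := linear_growth_obstacle M_ge0 phi_lip hA1.
have upv : usc_real (fun x => - v x - - phi x).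
  apply: usc_realD => //; apply: continuous_usc.
  rewrite (_ : (fun x => - - phi x) = phi); last by apply/funext => x; exact: opprK.
  exact: (lipschitz_continuous_rV phi_lip).
have [A2 _ hA2] : exists2 A, 0 <= A & forall x, - v x - - phi x <= A.
  by apply: (usc_bounded_above upv (r := r2) (c := 1)) => x /hr2; lra.
have Nphi_lip x y : `|- phi x - - phi y| <= M * `|x - y|.
  by rewrite -opprD normrN.
have [B2 _ vB] := linear_growth_obstacle M_ge0 Nphi_lip hA2.
apply: (comparison F_incr mu_gt0 M_ge0 N_ge0 phi_lip g_lip g_mono uu uv) => //.
- exact: (visc_subsol_pointwise sigma_12 F_incr F_0 F_lip subu uB).
- exact: (visc_supersol_pointwise sigma_12 F_incr F_0 F_lip supv vB).
Qed.

End viscosity_solutions.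

Theorem theorem1p3 (R : realType) (n : nat) (sigma L1 L2 L3 L4 L5 mu : R)
    (F : R -> R) (g : 'rV[R]_n -> R -> R) (phi : 'rV[R]_n -> R)
    (n_gt0 : (0 < n)%N) (sigma_12 : 1 < sigma < 2) (mu_gt0 : 0 < mu)
    (F_C1 : (forall t, derivable F t 1) /\ continuous (derive1 F))
    (F_0 : F 0 = 0)
    (F_lip : exists2 L, L < L1 & forall s t, `|F s - F t| <= L * `|s - t|)
    (F_incr : forall t, 0 < derive1 F t)
    (g_cont : continuous (fun p : 'rV[R]_n * R => g p.1 p.2))
    (g_lip : forall x x' t, x != x' -> `|g x t - g x' t| < L2 * enorm (x - x'))
    (g_mono : forall x s t, s < t -> mu * (t - s) <= g x t - g x s)
    (g_0 : forall x, g x 0 = 0)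
    (phi_convex : convex_function setT phi)
    (phi_C11 : C11 setT phi)
    (phi_hess : {ae lebesgue_rV n, forall x, differentiable (grad phi) x /\
      forall v : 'rV[R]_n,
        0 <= (v *m hess phi x *m v^T) ord0 ord0 <= L3 * enorm v ^+ 2})
    (phi_lip : forall x y, `|phi x - phi y| <= L4 * enorm (x - y))
    (phi_int : (\int[lebesgue_rV n]_y
      (`|phi y| * (1 / (1 + enorm y) `^ (n%:R + sigma)))%:E <= L5%:E)%E)
    (phi_cone : close_to_cone phi)
    (F_or_g : convex_function setT (fun t : R^o => - F t) \/ superlinear g) :
  exists! u : 'rV[R]_n -> R,
    visc_sol F sigma setT u (fun x => g x (u x - phi x)) /\
    vanishes_at_infinity (fun x => u x - phi x).
Proof.
have F_nd : {homo F : s t / s <= t}.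
  have [dF _] := F_C1; move=> s t st; rewrite -subr_ge0.
  have dF' (x : R) : is_derive x (1 : R) F (derive1 F x) by apply: DeriveDef; rewrite ?derive1E.
  have [|c _ ->] := MVT_segment st (fun x _ => dF' x).
    by apply: derivable_within_continuous => x _; exact: dF.
  by rewrite mulr_ge0 ?subr_ge0// ltW.
have [L _ F_lip'] := F_lip.
pose M := `|L4| * n%:R; pose N := `|L2| * n%:R.
have M0 : 0 <= M by rewrite mulr_ge0.
have N0 : 0 <= N by rewrite mulr_ge0.
have en (a : R) (x : 'rV[R]_n) : a * enorm x <= `|a| * n%:R * `|x|.
  rewrite (@le_trans _ _ (`|a| * enorm x))//.
    by rewrite ler_wpM2r ?enorm_ge0// ler_norm.
  by rewrite -mulrA ler_wpM2l// enorm_le_norm.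
have phi_lip' x y : `|phi x - phi y| <= M * `|x - y|.
  by rewrite (le_trans (phi_lip x y)).
have g_lip' x y t : `|g x t - g y t| <= N * `|x - y|.
  have [->|xy] := eqVneq x y; first by rewrite !subrr !normr0 mulr0.
  by rewrite (le_trans (ltW (g_lip x y t xy))).
have [u [cu subu supu phiu u_oo]] := perron_solution sigma_12 F_nd F_0 F_lip' mu_gt0
  g_cont N0 g_lip' g_mono g_0 phi_convex phi_C11 M0 phi_lip' phi_cone.
have uu : usc_real u by exact: continuous_usc.
have vu : vanishes_at_infinity (fun x => u x - phi x).
  apply: norm_vanishes => e e0; have [r hr] := u_oo e e0; exists r => x /hr.
  by rewrite ger0_norm ?subr_ge0.
have iu : weighted_L1 sigma u.
  have phic := lipschitz_continuous_rV phi_lip'.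
  have [r hr] := u_oo _ ltr01.
  have up : usc_real (fun x => u x - phi x).
    apply: usc_realD => //; apply: continuous_usc => x.
    by apply: (@cvgN _ _ _ (nbhs x)); exact: phic.
  have [A1 _ hA1] := usc_bounded_above up hr.
  have [B1 B10 uB] := linear_growth_obstacle M0 phi_lip' hA1.
  have [||B2 B20 uB'] := @linear_growth_obstacle _ _ M (fun x => - phi x) M0 _ (fun x => - u x) 0.
  - by move=> x y; rewrite -opprD normrN.
  - by move=> x; have := phiu x; lra.
  apply: (@weighted_L1_linear_growth _ _ sigma sigma_12 u (B1 + B2)).
    exact: usc_measurable.
  move=> z; have := uB z; have := uB' z; rewrite ler_norml mulrDl.
  have : 0 <= B1 * (1 + `|z|) by rewrite mulr_ge0// addr_ge0.
  have : 0 <= B2 * (1 + `|z|) by rewrite mulr_ge0// addr_ge0.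
  by move=> *; apply/andP; split; lra.
have su : visc_sol F sigma setT u (fun x => g x (u x - phi x)).
  split.
    by apply: pointwise_visc_subsol => //; exact/usc_realP.
  apply: pointwise_visc_supersol => //; apply/lscP; apply: continuous_usc => x.
  by apply: (@cvgN _ _ _ (nbhs x)); exact: cu.
exists u; split => // v [sv vv].
apply/funext => x; apply/eqP; rewrite eq_le; apply/andP; split.
- exact: (visc_sol_le sigma_12 F_nd F_0 F_lip' mu_gt0 N0 g_lip' g_mono M0 phi_lip' su vu sv vv).
- exact: (visc_sol_le sigma_12 F_nd F_0 F_lip' mu_gt0 N0 g_lip' g_mono M0 phi_lip' sv vv su vu).
Qed.
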